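(* Let $T>0$, let $\varepsilon$ be a nonzero real number with $|\varepsilon|<1$, and let $\Omega=\{(x,t): -\pi<x<\pi,\ 0<t<T\}$. Let $\varphi,\psi\in C^2[-\pi,\pi]$ with $\varphi''',\psi'''\in L_2(-\pi,\pi)$ and $\varphi^{(i)}(-\pi)=-\varphi^{(i)}(\pi)$, $\psi^{(i)}(-\pi)=-\psi^{(i)}(\pi)$ for $i=0,1,2$. Consider the inverse problem of finding a pair $(u,f)$ with $u\in C^{2,1}_{x,t}(\Omega)$, $f\in C[-\pi,\pi]$, such that $$u_t(x,t)-u_{xx}(x,t)+\varepsilon u_{xx}(-x,t)=f(x),\quad (x,t)\in\Omega,$$ $$u(x,0)=\varphi(x),\quad u(x,T)=\psi(x),\quad x\in[-\pi,\pi],$$ $$u(-\pi,t)=-u(\pi,t),\quad u_x(-\pi,t)=-u_x(\pi,t),\quad t\in[0,T].$$ Then a unique solution of this problem exists, and it is given by $$u(x,t)=\varphi(x)-\sum_{k=0}^\infty\frac{\left(1-e^{-(1-\varepsilon)(k+\frac12)^2t}\right)\left(\varphi^{(3)}_{2k}-\psi^{(3)}_{2k}\right)}{\left(1-e^{-(1-\varepsilon)(k+\frac12)^2T}\right)(k+\frac12)^3}\cos\left(k+\tfrac12\right)x+\sum_{k=0}^\infty\frac{\left(1-e^{-(1+\varepsilon)(k+\frac12)^2t}\right)\left(\varphi^{(3)}_{1k}-\psi^{(3)}_{1k}\right)}{\left(1-e^{-(1+\varepsilon)(k+\frac12)^2T}\right)(k+\frac12)^3}\sin\left(k+\tfrac12\right)x,$$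 $$f(x)=-\varphi''(x)+\varepsilon\varphi''(-x)-\sum_{k=0}^\infty\frac{(1-\varepsilon)\left(\varphi^{(3)}_{2k}-\psi^{(3)}_{2k}\right)}{(k+\frac12)\left(1-e^{-(1-\varepsilon)(k+\frac12)^2T}\right)}\cos\left(k+\tfrac12\right)x+\sum_{k=0}^\infty\frac{(1+\varepsilon)\left(\varphi^{(3)}_{1k}-\psi^{(3)}_{1k}\right)}{(k+\frac12)\left(1-e^{-(1+\varepsilon)(k+\frac12)^2T}\right)}\sin\left(k+\tfrac12\right)x,$$ where $$\varphi^{(3)}_{1k}=\frac1\pi\int_{-\pi}^\pi\varphi'''(x)\cos\left(k+\tfrac12\right)x\,dx,\quad \varphi^{(3)}_{2k}=\frac1\pi\int_{-\pi}^\pi\varphi'''(x)\sin\left(k+\tfrac12\right)x\,dx,$$ $$\psi^{(3)}_{1k}=\frac1\pi\int_{-\pi}^\pi\psi'''(x)\cos\left(k+\tfrac12\right)x\,dx,\quad \psi^{(3)}_{2k}=\frac1\pi\int_{-\pi}^\pi\psi'''(x)\sin\left(k+\tfrac12\right)x\,dx.$$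
   Context: $C^{2,1}_{x,t}(\Omega)$ denotes functions on $\Omega$ that are twice continuously differentiable in $x$ and once continuously differentiable in $t$. A pair $(u,f)$ with $u\in C^{2,1}_{x,t}(\Omega)$, $f\in C[-\pi,\pi]$ satisfying the equation and conditions is called a regular solution.
   Formalization: A solution is additionally required to have u continuous on the closed rectangle and u_x extending continuously to it, the condition on u_x being imposed on that extension; with u only in C^{2,1} of the open Ω, boundary values are not tied to the interior and uniqueness fails. *)

(* Defs.v *)
From HB Require Import structures.
From mathcomp Require Import all_boot all_order all_algebra.
From mathcomp Require Import all_classical all_reals all_analysis.
Set Implicit Arguments. Unset Strict Implicit. Unset Printing Implicit Defensive.
Import Order.TTheory GRing.Theory Num.Theory.
Import numFieldNormedType.Exports.
Local Open Scope classical_set_scope.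
Local Open Scope ring_scope.

Section Defs.
Variable R : realType.

(* f' is the derivative of f on the closed interval [a,b]
   (one-sided difference quotients at the endpoints). *)
Definition has_deriv_on (a b : R) (f f' : R -> R) : Prop :=
  forall x, a <= x <= b ->
    (fun h => h^-1 * (f (x + h) - f x)) @
      within (fun h => a <= x + h <= b) (0 : R)^' --> f' x.

Definition in_L2 (a b : R) (g : R -> R) : Prop :=
  measurable_fun `[a, b] g /\
  (\int[@lebesgue_measure R]_(x in `[a, b]) ((g x) ^+ 2)%:E < +oo)%E.

Definition Rint (a b : R) (g : R -> R) : R :=
  Rintegral (@lebesgue_measure R) `[a, b] g.

(* phi in C^2[-pi,pi] with derivatives phi1, phi2, and phi''' = phi3 in L_2:
   phi'' is absolutely continuous with derivative phi3 in L_2(-pi,pi). *)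
Definition C2_with_L2_third (phi phi1 phi2 phi3 : R -> R) : Prop :=
  [/\ has_deriv_on (- pi) pi phi phi1,
      has_deriv_on (- pi) pi phi1 phi2,
      {within `[- pi, pi], continuous phi2},
      in_L2 (- pi) pi phi3 &
      forall x, - pi <= x <= pi -> phi2 x = phi2 (- pi) + Rint (- pi) x phi3].

Definition antiperiodic3 (phi phi1 phi2 : R -> R) : Prop :=
  [/\ phi (- pi) = - phi pi, phi1 (- pi) = - phi1 pi & phi2 (- pi) = - phi2 pi].

Definition lam (k : nat) : R := k%:R + 2^-1.

Definition fcos_coef (g : R -> R) (k : nat) : R :=
  pi^-1 * Rint (- pi) pi (fun x => g x * cos (lam k * x)).
Definition fsin_coef (g : R -> R) (k : nat) : R :=
  pi^-1 * Rint (- pi) pi (fun x => g x * sin (lam k * x)).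

Definition series_sum (F : nat -> R) : R := limn (series F).
Definition series_cvg (F : nat -> R) : Prop := cvgn (series F).

Definition Omega (T : R) : set (R * R) :=
  [set p | - pi < p.1 < pi /\ 0 < p.2 < T].
Definition Omega_cl (T : R) : set (R * R) :=
  [set p | - pi <= p.1 <= pi /\ 0 <= p.2 <= T].

(* partial derivatives (two-sided, used in the open set Omega) *)
Definition dx (u : R -> R -> R) (x t : R) : R := derive1 (fun y => u y t) x.
Definition dxx (u : R -> R -> R) (x t : R) : R := derive1 (fun y => dx u y t) x.
Definition dt (u : R -> R -> R) (x t : R) : R := derive1 (fun s => u x s) t.

Definition uncurry2 (u : R -> R -> R) : R * R -> R := fun p => u p.1 p.2.

Definition C21 (T : R) (u : R -> R -> R) : Prop :=
  (forall x t, Omega T (x, t) ->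
     [/\ derivable (fun y => u y t) x 1,
         derivable (fun y => dx u y t) x 1 &
         derivable (fun s => u x s) t 1]) /\
  {in Omega T, continuous (uncurry2 u)} /\
  {in Omega T, continuous (uncurry2 (dx u))} /\
  {in Omega T, continuous (uncurry2 (dxx u))} /\
  {in Omega T, continuous (uncurry2 (dt u))}.

(* Regular solution (u,f) of the inverse problem.  The data conditions on the
   closed rectangle are understood with u continuous on the closure of Omega
   and u_x extending continuously to the closure of Omega (extension w). *)
Definition regular_solution (T eps : R) (phi psi : R -> R)
    (u : R -> R -> R) (f : R -> R) : Prop :=
  C21 T u /\
  {within Omega_cl T, continuous (uncurry2 u)} /\
  {within `[- pi, pi], continuous f} /\
  (forall x t, Omega T (x, t) ->
     dt u x t - dxx u x t + eps * dxx u (- x) t = f x) /\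
  (forall x, - pi <= x <= pi -> u x 0 = phi x /\ u x T = psi x) /\
  (forall t, 0 <= t <= T -> u (- pi) t = - u pi t) /\
  (exists w : R -> R -> R,
     [/\ {within Omega_cl T, continuous (uncurry2 w)},
         (forall x t, Omega T (x, t) -> w x t = dx u x t) &
         (forall t, 0 <= t <= T -> w (- pi) t = - w pi t)]).

Definition u_term1 (T eps : R) (a2 b2 : nat -> R) (x t : R) (k : nat) : R :=
  (1 - expR (- (1 - eps) * lam k ^+ 2 * t)) * (a2 k - b2 k)
  / ((1 - expR (- (1 - eps) * lam k ^+ 2 * T)) * lam k ^+ 3) * cos (lam k * x).
Definition u_term2 (T eps : R) (a1 b1 : nat -> R) (x t : R) (k : nat) : R :=
  (1 - expR (- (1 + eps) * lam k ^+ 2 * t)) * (a1 k - b1 k)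
  / ((1 - expR (- (1 + eps) * lam k ^+ 2 * T)) * lam k ^+ 3) * sin (lam k * x).
Definition f_term1 (T eps : R) (a2 b2 : nat -> R) (x : R) (k : nat) : R :=
  (1 - eps) * (a2 k - b2 k)
  / (lam k * (1 - expR (- (1 - eps) * lam k ^+ 2 * T))) * cos (lam k * x).
Definition f_term2 (T eps : R) (a1 b1 : nat -> R) (x : R) (k : nat) : R :=
  (1 + eps) * (a1 k - b1 k)
  / (lam k * (1 - expR (- (1 + eps) * lam k ^+ 2 * T))) * sin (lam k * x).

End Defs.

(* Main.v *)
(** Under x -> -x the equation decouples: on even functions -u_xx + eps u_xx(-x)
is -(1 - eps) u_xx, on odd ones -(1 + eps) u_xx, and the antiperiodic boundary
conditions select the system cos((k + 1/2) x), sin((k + 1/2) x). Each Fourier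
mode A of a solution satisfies A' + m A = F with m = (1 -+ eps)(k + 1/2)^2 and F
the corresponding mode of f, and the values of A at 0 and T determine F and A.
Since u is regular only inside Omega, the modes are first taken on [-b, b]; the
boundary terms of the integration by parts tend to 0 uniformly in t as b -> pi
because u and u_x extend continuously and are antiperiodic. A continuous function
is the sum of its antiperiodic Fourier series when the coefficients are summable,
which here follows from Bessel's inequality for phi3 and psi3. The same
bounds allow termwise differentiation of the series, whence existence. *)

Require Import Defs.
From HB Require Import structures.
From mathcomp Require Import all_boot all_order all_algebra.
From mathcomp Require Import all_classical all_reals all_analysis.
From mathcomp Require Import ring lra.
Import Order.TTheory GRing.Theory Num.Theory.
Import numFieldNormedType.Exports.
Local Open Scope classical_set_scope.
Local Open Scope ring_scope.

(** The regularity of the data is used up exactly. Bessel's inequality makes the coefficients of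
    [phi3] and [psi3] square-summable, and u v <= u^2 + v^2 turns this into summability of
    coefficient / [lam]. The amplitudes of the solution are of order coefficient / [lam]^3, so they
    are summable with the weight [lam]^2, which is the price of u_xx, u_t and f. The heat flow gives
    no extra decay in k: at a fixed t > 0 the profile 1 - exp(- m t) tends to 1. The denominators 1
    - exp(- m T) are harmless because the smallest one is at k = 0. The third derivative exists only
    as an L2 density of the absolutely continuous [phi2], so the last integration by parts cannot be
    the classical one; it is obtained by approximation in L1. Cosines and sines are treated
    together: a boolean selects the family, and a sign attached to it records parity, the signs of
    derivatives and the action of the reflection x -> -x. *)

Local Notation Rint := Defs.Rint.
Local Notation mu := lebesgue_measure.

(** * Series *)

Section DominatedSeries.
Context {R : realType}.
Implicit Types f g M : nat -> R.

Lemma dominated_cvg_series f M : cvgn (series M) ->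
  (forall k, `|f k| <= M k) -> cvgn (series f).
Proof.
move=> cM fM; apply: normed_cvg; apply: series_le_cvg cM => //.
- by move=> n /=.
- by move=> n; apply: le_trans (fM n); rewrite normr_ge0.
Qed.

Lemma series_tail_le f M N : cvgn (series M) -> (forall k, `|f k| <= M k) ->
  `|series_sum f - series f N| <= series_sum M - series M N.
Proof.
move=> cM fM; have cf := dominated_cvg_series _ _ cM fM.
have H : `|series f n - series f N| @[n --> \oo] --> `|series_sum f - series f N|.
  by apply: cvg_norm; apply: cvgB => //; exact: cvg_cst.
have H' : series M n - series M N @[n --> \oo] --> series_sum M - series M N.
  by apply: cvgB => //; exact: cvg_cst.
rewrite -(cvg_lim _ H)// -(cvg_lim _ H')//.
apply: ler_lim; [by apply/cvg_ex; exists (`|series_sum f - series f N|)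
  |by apply/cvg_ex; exists (series_sum M - series M N)|].
near=> n.
have Nn : (N <= n)%N by near: n; exact: nbhs_infty_ge.
by rewrite !sub_series_geq//; apply: le_trans (ler_norm_sum _ _ _) _; exact: ler_sum.
Unshelve. all: end_near. Qed.

(** Dominated convergence for series. The filter is arbitrary so that one proof covers continuity in
    x, continuity on the closed rectangle and limits of difference quotients. *)
Lemma tannery {T : Type} (F : set_system T) {FF : ProperFilter F}
    (g : T -> nat -> R) l M : cvgn (series M) ->
  (\forall x \near F, forall k, `|g x k| <= M k) ->
  (forall k, g x k @[x --> F] --> l k) ->
  series_sum (g x) @[x --> F] --> series_sum l.
Proof.
move=> cM gM gl.
have lM k : `|l k| <= M k.
  have H : `|g x k| @[x --> F] --> `|l k| by apply: cvg_norm; exact: gl.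
  rewrite -(cvg_lim _ H)//; apply: limr_le.
    by apply/cvg_ex; exists (`|l k|).
  by near=> x; have : forall k, `|g x k| <= M k by near: x.
apply/cvgrPdist_lt => /= e e0.
have e3 : 0 < e / 3 by rewrite divr_gt0.
have [N _ HN] := (cvgrPdist_lt _ _).1 cM _ e3.
have {}HN := HN N (leqnn N); rewrite /= in HN.
have HNs : series_sum M - series M N < e / 3 by apply: le_lt_trans HN; exact: ler_norm.
have gNl : series (g x) N @[x --> F] --> series l N.
  elim: N {HN HNs} => [|N IH].
    rewrite /series /= big_geq//; under eq_fun do rewrite big_geq//.
    exact: cvg_cst.
  by rewrite seriesSr; under eq_fun do rewrite seriesSr; exact: cvgD.
near=> x.
have gx : forall k, `|g x k| <= M k by near: x.
have xN : `|series l N - series (g x) N| < e / 3.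
  by near: x; exact: (cvgrPdist_lt _ _).1 gNl _ e3.
have t1 := series_tail_le _ _ N cM lM.
have t2 := series_tail_le _ _ N cM gx.
rewrite distrC in t2.
have -> : series_sum l - series_sum (g x) = (series_sum l - series l N) +
  (series l N - series (g x) N) + (series (g x) N - series_sum (g x)) by ring.
apply: le_lt_trans (ler_normD _ _) _.
apply: (le_lt_trans (lerD (ler_normD _ _) (lexx _))).
by rewrite (_ : e = e / 3 + e / 3 + e / 3); [lra|field].
Unshelve. all: end_near. Qed.

Lemma series_sumB f g : series_cvg f -> series_cvg g ->
  series_sum (fun k => f k - g k) = series_sum f - series_sum g.
Proof. exact: lim_seriesB. Qed.

Lemma series_sumD f g : series_cvg f -> series_cvg g ->
  series_sum (fun k => f k + g k) = series_sum f + series_sum g.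
Proof. exact: lim_seriesD. Qed.

Lemma series_sumZ (c : R) f : series_cvg f ->
  series_sum (fun k => c * f k) = c * series_sum f.
Proof. exact: lim_seriesZ. Qed.

Lemma eq_series_sum f g : f =1 g -> series_sum f = series_sum g.
Proof. by move=> fg; congr (series_sum _); exact/funext. Qed.

Lemma cvg_series_scale (B : R) (f : nat -> R) : cvgn (series f) ->
  cvgn (series (fun k => B * f k)).
Proof. exact: is_cvg_seriesZ. Qed.

Lemma cvg_series_add (f g : nat -> R) : cvgn (series f) -> cvgn (series g) ->
  cvgn (series (fun k => f k + g k)).
Proof. exact: is_cvg_seriesD. Qed.

End DominatedSeries.

(** * Integration by parts *)

Section RiemannTools.
Context {R : realType}.
Implicit Types (a b x : R) (f g F G : R -> R).

Lemma within_continuous_integrable a b f : {within `[a, b], continuous f} ->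
  mu.-integrable `[a, b] (EFin \o f).
Proof.
by move=> cf; apply: continuous_compact_integrable => //; exact: segment_compact.
Qed.

Lemma within_continuousM {X : topologicalType} (A : set X) (f g : X -> R) :
  {within A, continuous f} -> {within A, continuous g} ->
  {within A, continuous (fun z => f z * g z)}.
Proof. by move=> cf cg z; apply: continuousM; [exact: cf|exact: cg]. Qed.

Lemma within_continuousD {X : topologicalType} (A : set X) (f g : X -> R) :
  {within A, continuous f} -> {within A, continuous g} ->
  {within A, continuous (fun z => f z + g z)}.
Proof. by move=> cf cg z; apply: continuousD; [exact: cf|exact: cg]. Qed.

Lemma within_continuousB {X : topologicalType} (A : set X) (f g : X -> R) :
  {within A, continuous f} -> {within A, continuous g} ->
  {within A, continuous (fun z => f z - g z)}.
Proof. by move=> cf cg z; apply: continuousB; [exact: cf|exact: cg]. Qed.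

Lemma within_continuous_comp {X Y Z : topologicalType} (A : set X) (B : set Y)
    (f : Y -> Z) (g : X -> Y) : {within B, continuous f} -> continuous g ->
  (forall z, A z -> B (g z)) -> {within A, continuous (fun z => f (g z))}.
Proof.
move=> /subspace_continuousP cf cg AB; apply/subspace_continuousP => x Ax.
apply: cvg_trans (cf _ (AB _ Ax)).
move=> P /= HP; have := cg x _ HP; rewrite /= !nbhs_simpl /within /=.
by apply: filterS => y H Ay; exact: H (AB _ Ay).
Qed.

Lemma within_continuousT {X : topologicalType} (A : set X) (f : X -> R) : continuous f -> {within A, continuous f}.
Proof. exact: continuous_subspaceT. Qed.

Lemma within_continuous_cst {X : topologicalType} (A : set X) (c : R) : {within A, continuous (fun=> c : R)}.
Proof. by apply: within_continuousT => x; exact: cst_continuous. Qed.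

Lemma eq_Rint a b f g : (forall x, a <= x <= b -> f x = g x) ->
  Rint a b f = Rint a b g.
Proof.
move=> fg; apply: eq_Rintegral => x; rewrite inE/= in_itv/=; exact: fg.
Qed.

Lemma RintD a b f g :
  mu.-integrable `[a, b] (EFin \o f) ->
  mu.-integrable `[a, b] (EFin \o g) ->
  Rint a b (fun x => f x + g x) = Rint a b f + Rint a b g.
Proof. by move=> fi gi; exact: RintegralD. Qed.

Lemma RintB a b f g :
  mu.-integrable `[a, b] (EFin \o f) ->
  mu.-integrable `[a, b] (EFin \o g) ->
  Rint a b (fun x => f x - g x) = Rint a b f - Rint a b g.
Proof. by move=> fi gi; exact: RintegralB. Qed.

Lemma RintZ a b (c : R) f :
  mu.-integrable `[a, b] (EFin \o f) ->
  Rint a b (fun x => c * f x) = c * Rint a b f.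
Proof. by move=> fi; exact: RintegralZl. Qed.

Lemma Rint_cst a b (c : R) : a <= b -> Rint a b (fun=> c) = c * (b - a).
Proof.
move=> ab; rewrite /Rint Rintegral_cst//= lebesgue_measure_itv/= lte_fin.
by move: ab; rewrite le_eqVlt => /predU1P[->|->]; rewrite ?ltxx ?subrr.
Qed.

Lemma Rint_norm_le a b f (M : R) : a <= b ->
  mu.-integrable `[a, b] (EFin \o f) ->
  (forall x, a <= x <= b -> `|f x| <= M) -> `|Rint a b f| <= M * (b - a).
Proof.
move=> ab fi fM; rewrite -Rint_cst//.
apply: le_trans (le_normr_Rintegral _ fi) _ => //.
apply: le_Rintegral => //.
- exact: integrable_norm.
- exact/within_continuous_integrable/within_continuous_cst.
Qed.

Lemma Rint_split a b c f : a <= b -> b <= c ->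
  mu.-integrable `[a, c] (EFin \o f) ->
  Rint a c f = Rint a b f + Rint b c f.
Proof.
move=> ab bc fi.
have fi' : mu.-integrable `]b, c] (EFin \o f).
  by apply: integrableS fi => //; apply: subset_itv; rewrite bnd_simp.
have := @Rintegral_itvB R f (BLeft a) (BRight c) b fi.
rewrite !bnd_simp => /(_ ab bc) /eqP; rewrite subr_eq => /eqP.
rewrite /Rint => ->; rewrite addrC; congr (_ + _).
by rewrite Rintegral_itv_obnd_cbnd.
Qed.

(** The increment of [f] is h times the difference quotient, hence tends to 0, at the endpoints too,
    where the filter keeps only the admissible h. *)
Lemma has_deriv_on_within_continuous a b f g : has_deriv_on a b f g ->
  {within `[a, b], continuous f}.
Proof.
move=> df; apply/subspace_continuousP => x /=; rewrite in_itv/= => xab.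
have := df x xab.
have h0 : (fun h => h) @ within (fun h => a <= x + h <= b) (0 : R)^' --> (0 : R).
  apply: cvg_trans (cvg_within _) _.
  by move=> P /nbhs_dnbhs.
move=> /(cvgM h0); rewrite mul0r => H.
apply/cvgrPdist_lt => e e0.
move/cvgrPdist_lt : H => /(_ e e0).
rewrite near_withinE near_withinE => -[r /= r0 H].
exists r => //= y xy yab.
have [->|yx] := eqVneq y x; first by rewrite subrr normr0.
have := H (y - x); rewrite /= !sub0r distrC opprB.
move=> /(_ xy); rewrite subr_eq0 => /(_ yx).
rewrite addrC subrK; move: yab; rewrite in_itv/= => yab /(_ yab).
by rewrite mulrA mulfV ?subr_eq0// mul1r normrN distrC.
Qed.

(** At an interior point every small h is admissible, so the restricted limit is the two-sided
    one. *)
Lemma has_deriv_on_is_derive a b f g x : has_deriv_on a b f g -> a < x < b ->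
  is_derive x 1 f (g x).
Proof.
move=> df /andP[ax xb].
have := df x; rewrite !ltW// => /(_ isT) H.
have {}H : h^-1 * (f (x + h) - f x) @[h --> 0^'] --> g x.
  apply: cvg_trans H; apply: cvg_app.
  move=> P; rewrite !near_simpl /within /= /nbhs/= => HP.
  have HN : \forall h \near (0 : R)^', a <= x + h <= b.
    have : \forall h \near (0 : R), a <= x + h <= b.
      have hc : (fun h : R => x + h) @ (0 : R) --> x + 0.
        by apply: cvgD; [exact: cvg_cst|exact: cvg_id].
      rewrite addr0 in hc.
      near=> h; apply/andP; split; apply: ltW.
        near: h; exact: (cvgr_gt x).
      near: h; exact: (cvgr_lt x).
    exact: nbhs_dnbhs.
  by near=> h; have : a <= x + h <= b by [near: h]; near: h; exact: HP.
have {}H : h^-1 *: (f (h *: 1 + x) - f x) @[h --> 0^'] --> g x.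
  apply: cvg_trans H; apply: near_eq_cvg; near=> h.
  by rewrite /= [h *: _]mulr1 [x + _]addrC.
apply: DeriveDef; first by apply/cvg_ex; exists (g x).
exact: cvg_lim.
Unshelve. all: end_near. Qed.

Lemma Rint_by_parts a b F f G g : a < b ->
  {within `[a, b], continuous f} -> {within `[a, b], continuous F} ->
  (forall x, a < x < b -> is_derive x 1 F (f x)) ->
  {within `[a, b], continuous g} -> {within `[a, b], continuous G} ->
  (forall x, a < x < b -> is_derive x 1 G (g x)) ->
  Rint a b (fun x => F x * g x) = F b * G b - F a * G a - Rint a b (fun x => f x * G x).
Proof.
move=> ab cf cF dF cg cG dG; rewrite /Rint; apply: Rintegration_by_parts => //.
- have [? ? ?] := (continuous_within_itvP _ ab).1 cF.
  split => // x; rewrite in_itv/= => /dF[] //.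
- by move=> x; rewrite in_itv/= => /dF[] ? <-; rewrite derive1E.
- have [? ? ?] := (continuous_within_itvP _ ab).1 cG.
  split => // x; rewrite in_itv/= => /dG[] //.
- by move=> x; rewrite in_itv/= => /dG[] ? <-; rewrite derive1E.
Qed.

End RiemannTools.

(** * Integration by parts against an absolutely continuous function *)

Section AbsolutelyContinuousByParts.
Context {R : realType}.
Implicit Types (a b x : R) (f g p F G : R -> R).

Lemma within_continuous_bounded a b f : a <= b -> {within `[a, b], continuous f} ->
  exists2 M : R, 0 < M & forall x, a <= x <= b -> `|f x| <= M.
Proof.
move=> ab cf.
have cf' : {within `[a, b], continuous (fun x => `|f x|)}.
  by move=> z; apply: continuous_comp; [exact: cf|exact: norm_continuous].
have [c _ cmax] := EVT_max ab cf'.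
exists (`|f c| + 1); first by rewrite ltr_wpDl.
move=> x xab; have := cmax x; rewrite in_itv/= => /(_ xab) h.
by apply: le_trans h _; rewrite lerDl.
Qed.

Lemma integrable_mul_continuous a b p G : a <= b ->
  mu.-integrable `[a, b] (EFin \o p) -> {within `[a, b], continuous G} ->
  mu.-integrable `[a, b] (EFin \o (fun x => p x * G x)).
Proof.
move=> ab ip cG; have [M M0 GM] := within_continuous_bounded _ _ _ ab cG.
apply: (integrableMl _ ip) => //.
  by have /integrableP[/measurable_realfun.measurable_EFinP] := within_continuous_integrable _ _ _ cG.
exists M; split; first exact: num_real.
by move=> N MN x /=; rewrite in_itv/= => /GM /le_trans; apply; exact: ltW.
Qed.

(** Continuity of the pairing with [G] in the L1 norm of [p], as needed for the density argument
    below. *)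
Lemma Rint_norm_mul_le a b p G (K : R) : a <= b ->
  mu.-integrable `[a, b] (EFin \o p) -> {within `[a, b], continuous G} ->
  (forall x, a <= x <= b -> `|G x| <= K) ->
  `|Rint a b (fun x => p x * G x)| <= K * Rint a b (fun x => `|p x|).
Proof.
move=> ab ip cG GK.
have ipn : mu.-integrable `[a, b] (EFin \o (fun x => `|p x|)) by exact: integrable_norm.
rewrite -RintZ//; apply: le_trans (le_normr_Rintegral _ _) _ => //.
  exact: integrable_mul_continuous.
apply: le_Rintegral => //.
- by apply: integrable_norm; exact: integrable_mul_continuous.
- exact: (integrableZl _ K ipn).
- move=> x; rewrite /= in_itv/= => /GK h; rewrite normrM mulrC.
  exact: ler_wpM2r.
Qed.

Lemma integrable_subinterval a b x p : x <= b ->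
  mu.-integrable `[a, b] (EFin \o p) -> mu.-integrable `[a, x] (EFin \o p).
Proof.
move=> xb; apply: integrableS => //; apply: subset_itvl; by rewrite bnd_simp.
Qed.

Lemma primitive_continuous a b p : a <= b -> mu.-integrable `[a, b] (EFin \o p) ->
  {within `[a, b], continuous (fun x => Rint a x p)}.
Proof. exact: parameterized_integral_continuous. Qed.

Lemma primitive_norm_le a b p x : a <= x <= b -> mu.-integrable `[a, b] (EFin \o p) ->
  `|Rint a x p| <= Rint a b (fun y => `|p y|).
Proof.
move=> /andP[ax xb] ip.
have ipn : mu.-integrable `[a, b] (EFin \o (fun x => `|p x|)) by exact: integrable_norm.
rewrite (Rint_split a x b (fun y => `|p y|))//.
apply: (@le_trans _ _ (Rint a x (fun y => `|p y|))).
  by apply: le_normr_Rintegral => //; exact: integrable_subinterval ip.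
by rewrite lerDl; exact: Rintegral_ge0.
Qed.

Lemma primitive_is_derive a b p x : a < x < b ->
  mu.-integrable `[a, b] (EFin \o p) -> {for x, continuous p} ->
  is_derive x 1 (fun x => Rint a x p) (p x).
Proof.
move=> /andP[ax xb] ip cp.
have [d e] := continuous_FTC1_closed xb ip ax cp.
apply: DeriveDef; first exact: d.
by rewrite -derive1E e.
Qed.

(** For continuous [p] the primitive is differentiable inside the interval and the classical formula
    applies; the boundary term at [a] vanishes since the primitive starts there. *)
Let parts_smooth a b p G g : a < b -> continuous p ->
  {within `[a, b], continuous g} -> {within `[a, b], continuous G} ->
  (forall x, a < x < b -> is_derive x 1 G (g x)) ->
  Rint a b (fun x => p x * G x) =
    Rint a b p * G b - Rint a b (fun x => Rint a x p * g x).
Proof.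
move=> ab cp cg cG dG.
have ip : mu.-integrable `[a, b] (EFin \o p).
  by apply: within_continuous_integrable; exact: within_continuousT.
have := Rint_by_parts a b (fun x => Rint a x p) p G g ab
   (within_continuousT _ _ cp) (primitive_continuous _ _ _ (ltW ab) ip).
have dP x : a < x < b -> is_derive x 1 (fun x => Rint a x p) (p x).
  by move=> xab; apply: primitive_is_derive xab ip _; exact: cp.
move=> /(_ dP cg cG dG).
have -> : Rint a a p = 0 by rewrite /Rint set_itv1 Rintegral_set1.
by rewrite mul0r subr0 => ->; rewrite opprB addrC subrK.
Qed.

(* Both sides are continuous in p for the L1 norm, and continuous functions are
   dense in L1. *)
Lemma Rint_primitive_by_parts a b p G g : a < b ->
  mu.-integrable `[a, b] (EFin \o p) ->
  {within `[a, b], continuous g} -> {within `[a, b], continuous G} ->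
  (forall x, a < x < b -> is_derive x 1 G (g x)) ->
  Rint a b (fun x => p x * G x) =
    Rint a b p * G b - Rint a b (fun x => Rint a x p * g x).
Proof.
move=> ab ip cg cG dG; have ab' := ltW ab.
have [K K0 GK] := within_continuous_bounded _ _ _ ab' cG.
have [L L0 gL] := within_continuous_bounded _ _ _ ab' cg.
have [q [cq iq pq]] := approximation_continuous_integrable (measurable_itv `[a, b])
  (ltac:(by rewrite /= lebesgue_measure_itv/=; case: ifP => _; rewrite ?ltry)) ip.
(* [D] is the defect of the formula: additive under differences by [DB], bounded in L1 by [Dle], and
   zero on continuous functions. *)
set D := fun p => Rint a b (fun x => p x * G x) - Rint a b p * G b
   + Rint a b (fun x => Rint a x p * g x).
have DB p1 p2 : mu.-integrable `[a, b] (EFin \o p1) ->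
    mu.-integrable `[a, b] (EFin \o p2) -> D (fun x => p1 x - p2 x) = D p1 - D p2.
  move=> i1 i2; rewrite /D RintB//.
  rewrite (_ : Rint a b (fun x => (p1 x - p2 x) * G x) =
    Rint a b (fun x => p1 x * G x) - Rint a b (fun x => p2 x * G x)); last first.
    rewrite -RintB; [|exact: integrable_mul_continuous..].
    by apply: eq_Rint => x _; rewrite mulrBl.
  rewrite (_ : Rint a b (fun x => Rint a x (fun x => p1 x - p2 x) * g x) =
    Rint a b (fun x => Rint a x p1 * g x) - Rint a b (fun x => Rint a x p2 * g x)); last first.
    rewrite -RintB; [|by apply: within_continuous_integrable;
       apply: within_continuousM => //; exact: primitive_continuous..].
    apply: eq_Rint => x /andP[ax xb]; rewrite RintB; last 2 first.
      exact: integrable_subinterval i1.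
      exact: integrable_subinterval i2.
    by rewrite mulrBl.
  by move: (Rint _ _ _) (Rint _ _ _) (Rint _ _ _) (Rint _ _ _) (Rint _ _ _) (Rint _ _ _) => *; ring.
(* One summand for each term of [D]: the pairing with [G], the boundary term, and the primitive
   integrated against [g]. *)
set C := K + K + L * (b - a).
have Dle p1 : mu.-integrable `[a, b] (EFin \o p1) ->
    `|D p1| <= C * Rint a b (fun x => `|p1 x|).
  move=> i1; set N := Rint a b (fun x => `|p1 x|).
  have N0 : 0 <= N by exact: Rintegral_ge0.
  have h1 := Rint_norm_mul_le _ _ _ _ _ ab' i1 cG GK.
  have h2 : `|Rint a b p1 * G b| <= K * N.
    rewrite normrM mulrC ler_pM//; first by apply: GK; rewrite ab' lexx.
    by apply: primitive_norm_le => //; rewrite ab' lexx.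
  have h3 : `|Rint a b (fun x => Rint a x p1 * g x)| <= L * N * (b - a).
    apply: Rint_norm_le => //.
      apply: within_continuous_integrable; apply: within_continuousM => //.
      exact: primitive_continuous.
    move=> x xab; rewrite normrM mulrC ler_pM//; first exact: gL.
    exact: primitive_norm_le.
  rewrite /D; apply: le_trans (ler_normD _ _) _.
  apply: le_trans (lerD (ler_normB _ _) (lexx _)) _.
  rewrite /C -/N in h1 *; lra.
have C0 : 0 < C by rewrite /C !addr_gt0 ?mulr_gt0// subr_gt0.
suff : D p = 0 by rewrite /D => h; lra.
apply/eqP; rewrite -normr_le0; apply/ler_addgt0Pr => e e0; rewrite add0r.
have eC : 0 < e / C by rewrite divr_gt0.
have pq' : Rint a b (fun x => `|p x - q n x|) @[n --> \oo] --> 0.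
  by apply: fine_cvg; exact: pq.
have [n _ /(_ n (leqnn n)) hn] := (cvgrPdist_le _ _).1 pq' _ eC.
have iB : mu.-integrable `[a, b] (EFin \o (fun x => p x - q n x)).
  exact: (integrableB _ ip (iq n)).
have Dq : D (q n) = 0 by rewrite /D (parts_smooth _ _ _ _ _ ab (cq n) cg cG dG); ring.
rewrite -[D p]subr0 -Dq -DB//; apply: le_trans (Dle _ iB) _.
rewrite mulrC -ler_pdivlMr//; apply: le_trans hn; rewrite sub0r normrN.
exact: ler_norm.
Qed.

End AbsolutelyContinuousByParts.

(** * The antiperiodic trigonometric system *)

Section TrigonometricSystem.
Context {R : realType}.
Implicit Types (c d : bool) (j k : nat) (x : R).

(** [true] is the even family and [false] the odd one; differentiation exchanges them, so it acts on
    the index as negation. *)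
Definition trig c k x : R := if c then cos (lam R k * x) else sin (lam R k * x).
(** The parity of [trig c]. The same sign, negated, appears in its derivative, and 1 - [par c] * eps
    is what u(x) - eps u(-x) contributes to a mode of family [c]. *)
Definition par c : R := if c then 1 else - 1.

Lemma parN c : par (~~ c) = - par c.
Proof. by case: c; rewrite /par /= ?opprK. Qed.

Lemma par2 c : par c * par c = 1.
Proof. by case: c; rewrite /par ?mulrNN mulr1. Qed.

Lemma norm_par c : `|par c| = 1.
Proof. by case: c; rewrite /par ?normrN normr1. Qed.

Lemma lam_gt0 k : 0 < lam R k.
Proof. by rewrite /lam ltr_wpDl// invr_gt0. Qed.

Lemma lamX_gt0 k n : 0 < lam R k ^+ n.
Proof. by rewrite exprn_gt0// lam_gt0. Qed.

Lemma lam_neq0 k : lam R k != 0.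
Proof. by rewrite gt_eqF// lam_gt0. Qed.

Lemma lam_ge k : 2^-1 <= lam R k.
Proof. by rewrite /lam lerDr. Qed.

Lemma lam_inj j k : lam R j ^+ 2 = lam R k ^+ 2 -> j = k.
Proof.
move/eqP; rewrite eqf_sqr => /orP[/eqP /addIr /eqP|/eqP h].
  by rewrite eqr_nat => /eqP.
by have := lam_gt0 j; rewrite h oppr_gt0 ltNge ltW// lam_gt0.
Qed.

Lemma trig_parity c k x : trig c k (- x) = par c * trig c k x.
Proof. by case: c; rewrite /trig /par mulrN ?cosN ?sinN ?mul1r ?mulN1r. Qed.

Lemma cos_lam_pi k : cos (lam R k * pi) = 0.
Proof.
elim: k => [|k IH]; first by rewrite /lam add0r mulrC cos_pihalf.
by rewrite /lam -natr1 addrAC mulrDl mul1r cosDpi IH oppr0.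
Qed.

Lemma trig_antiperiodic c k : trig c k (- pi) = - trig c k pi.
Proof. by rewrite trig_parity; case: c; rewrite /par /trig ?cos_lam_pi ?mulr0 ?oppr0 ?mulN1r. Qed.

Lemma trig_le1 c k x : `|trig c k x| <= 1.
Proof. by case: c; rewrite /trig ?cos_max ?sin_max. Qed.

Lemma is_derive_trig c k x :
  is_derive x 1 (trig c k) (- par c * lam R k * trig (~~ c) k x).
Proof.
have d : is_derive x 1 (fun y => lam R k * y) (lam R k).
  have h := is_deriveZ (lam R k) (is_derive_id x (1 : R)).
  by apply: is_derive_eq h _; rewrite /GRing.scale /= mulr1.
case: c; rewrite /par /trig /=.
  have := @is_derive1_comp _ cos (fun y => lam R k * y) x _ _ (is_derive_cos _) d.
  by move=> h; apply: is_derive_eq h _; rewrite mulN1r mulNr mulrC mulrN.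
have := @is_derive1_comp _ sin (fun y => lam R k * y) x _ _ (is_derive_sin _) d.
by move=> h; apply: is_derive_eq h _; rewrite opprK mul1r mulrC.
Qed.

Lemma continuous_trig c k : continuous (trig c k).
Proof.
move=> x; apply: differentiable_continuous; apply/derivable1_diffP.
exact: (@ex_derive _ _ _ _ _ _ _ (is_derive_trig c k x)).
Qed.

Lemma within_continuous_trig (a b : R) c k : {within `[a, b], continuous (trig c k)}.
Proof. exact/within_continuousT/continuous_trig. Qed.

Lemma trig_lipschitz c k x y : `|trig c k x - trig c k y| <= lam R k * `|x - y|.
Proof.
wlog xy : x y / y < x.
  move=> H; have [xy|xy|->] := ltgtP x y; last by rewrite !subrr normr0 mulr0.
    by rewrite distrC (distrC x); exact: H.
  exact: H.
have [z _ ->] := @MVT _ (trig c k) (fun z => - par c * lam R k * trig (~~ c) k z) _ _ xy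
  (fun z _ => is_derive_trig c k z) (within_continuous_trig _ _ _ _).
rewrite normrM ler_wpM2r// !normrM normrN norm_par mul1r gtr0_norm ?lam_gt0//.
by rewrite ler_piMr ?trig_le1// ltW// lam_gt0.
Qed.

Definition inner (g h : R -> R) : R := Rint (- pi) pi (fun x => g x * h x).

Lemma oppr_pi_lt : - pi < pi :> R.
Proof. by rewrite ltrNl (lt_trans _ (pi_gt0 R))// oppr_lt0 pi_gt0. Qed.

Lemma oppr_pi_le : - pi <= pi :> R.
Proof. exact/ltW/oppr_pi_lt. Qed.

Lemma inner_deriv_trig (F f : R -> R) c k :
  {within `[- pi, pi], continuous f} -> {within `[- pi, pi], continuous F} ->
  (forall x, - pi < x < pi -> is_derive x 1 F (f x)) -> F (- pi) = - F pi ->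
  inner f (trig c k) = par c * lam R k * inner F (trig (~~ c) k).
Proof.
move=> cf cF dF aF.
have cg : {within `[- pi, pi], continuous (fun x => - par c * lam R k * trig (~~ c) k x)}.
  apply: within_continuousM; last exact: within_continuous_trig.
  exact/within_continuous_cst.
have := Rint_by_parts _ _ _ _ _ _ oppr_pi_lt cf cF dF cg (within_continuous_trig _ _ c k)
  (fun x _ => is_derive_trig c k x).
rewrite aF trig_antiperiodic mulrNN subrr sub0r => h.
rewrite /inner; apply: oppr_inj; rewrite -h -!mulNr -RintZ.
  by apply: eq_Rint => x _; ring.
apply/within_continuous_integrable/within_continuousM => //.
exact: within_continuous_trig.
Qed.

(** The version of [inner_deriv_trig] for an [F] without a pointwise derivative. The primitive of
    [p] differs from [F] by the constant [F (- pi)] and is not antiperiodic itself, so its boundary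
    term survives and must be matched with the contribution of that constant. *)
Lemma inner_primitive_trig (F p : R -> R) c k :
  mu.-integrable `[- pi, pi] (EFin \o p) ->
  (forall x, - pi <= x <= pi -> F x = F (- pi) + Rint (- pi) x p) ->
  F (- pi) = - F pi ->
  inner p (trig c k) = par c * lam R k * inner F (trig (~~ c) k).
Proof.
move=> ip Fp aF.
have cg : {within `[- pi, pi], continuous (fun x => - par c * lam R k * trig (~~ c) k x)}.
  apply: within_continuousM; last exact: within_continuous_trig.
  exact/within_continuous_cst.
have Pc := primitive_continuous _ _ _ oppr_pi_le ip.
have ctr b : {within `[- pi, pi], continuous (trig b k)} by exact: within_continuous_trig.
rewrite /inner (Rint_primitive_by_parts _ _ _ _ _ oppr_pi_lt ip cg (ctr c)
  (fun x _ => is_derive_trig c k x)).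
have FE : Rint (- pi) pi (fun x => F x * trig (~~ c) k x) =
   F (- pi) * Rint (- pi) pi (trig (~~ c) k) +
   Rint (- pi) pi (fun x => Rint (- pi) x p * trig (~~ c) k x).
  rewrite -RintZ; last exact/within_continuous_integrable.
  rewrite -RintD.
  - by apply: eq_Rint => x xpi; rewrite Fp// mulrDl.
  - apply/within_continuous_integrable/within_continuousM => //.
    exact/within_continuous_cst.
  - by apply/within_continuous_integrable/within_continuousM.
have PE : Rint (- pi) pi (fun x => Rint (- pi) x p * (- par c * lam R k * trig (~~ c) k x))
   = - (par c * lam R k) * Rint (- pi) pi (fun x => Rint (- pi) x p * trig (~~ c) k x).
  rewrite -RintZ; last by apply/within_continuous_integrable/within_continuousM.
  by apply: eq_Rint => x _; ring.
(* Integrating the derivative of [trig c k] over the interval gives twice its value at pi, by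
   antiperiodicity. *)
have I1 : trig c k pi *+ 2 = - (par c * lam R k) * Rint (- pi) pi (trig (~~ c) k).
  have := Rint_by_parts _ _ (fun=> 1) (fun=> 0) _ _ oppr_pi_lt
    (within_continuous_cst _ _) (within_continuous_cst _ _)
    (fun x _ => is_derive_cst (1 : R) x 1) cg (ctr c) (fun x _ => is_derive_trig c k x).
  rewrite trig_antiperiodic !mul1r opprK -mulr2n.
  rewrite (eq_Rint _ _ (fun x => 0 * _ x) (fun=> 0)); last by move=> x _; rewrite mul0r.
  rewrite Rint_cst ?oppr_pi_le// mul0r subr0 => <-.
  rewrite -RintZ; last exact/within_continuous_integrable.
  by apply: eq_Rint => x _; rewrite mul1r mulNr.
rewrite FE PE.
(* The total increment of an antiperiodic function is minus twice its initial value. *)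
have Ppi : Rint (- pi) pi p = - F (- pi) *+ 2.
  have := Fp pi; rewrite oppr_pi_le lexx => /(_ isT) h.
  have -> : Rint (- pi) pi p = F pi - F (- pi) by rewrite h addrAC subrr add0r.
  by rewrite -[F pi]opprK -aF mulr2n.
rewrite Ppi.
have I2 : - F (- pi) *+ 2 * trig c k pi = par c * lam R k * (F (- pi) * Rint (- pi) pi (trig (~~ c) k)).
  by rewrite mulrnAl -mulrnAr I1; ring.
by rewrite I2; ring.
Qed.

Lemma inner_trig_swap c d j k :
  - par d * lam R j * inner (trig (~~ d) j) (trig c k) =
  par c * lam R k * inner (trig d j) (trig (~~ c) k).
Proof.
have cg : {within `[- pi, pi], continuous (fun x => - par d * lam R j * trig (~~ d) j x)}.
  apply: within_continuousM; last exact: within_continuous_trig.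
  exact/within_continuous_cst.
have <- := inner_deriv_trig (trig d j) _ c k cg (within_continuous_trig _ _ _ _)
  (fun x _ => is_derive_trig d j x) (trig_antiperiodic d j).
rewrite /inner -RintZ; first by apply: eq_Rint => x _; rewrite mulrA.
by apply/within_continuous_integrable/within_continuousM; exact: within_continuous_trig.
Qed.

(** Orthogonality as for eigenfunctions of a symmetric operator, without product-to-sum formulas:
    shifting a derivative from one factor to the other twice multiplies the inner product by
    [lam]_k^2 / [lam]_j^2, so it vanishes for j != k. *)
Lemma inner_trig c d j k :
  inner (trig c j) (trig d k) = if (c == d) && (j == k) then pi else 0.
Proof.
have lj := lam_neq0 j; have lk := lam_neq0 k.
have [->|jk] := eqVneq j k; last first.
  rewrite andbF.
  have l2 : lam R j ^+ 2 - lam R k ^+ 2 != 0.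
    by rewrite subr_eq0; apply: contra jk => /eqP /lam_inj ->.
  apply: (mulfI l2); rewrite mulr0.
  have h1 := inner_trig_swap d (~~ c) j k.
  have h2 := inner_trig_swap (~~ d) c j k.
  rewrite !negbK !parN ?opprK in h1 h2.
  have p1 := par2 c; have p2 := par2 d.
  have e1 : lam R j * inner (trig c j) (trig d k) =
            par c * par d * lam R k * inner (trig (~~ c) j) (trig (~~ d) k).
    by rewrite -[LHS]mul1r -p1; rewrite [in RHS](_ : forall y z t u : R, y * z * t * u = y * (z * t * u))//; [rewrite -h1; ring|move=> *; ring].
  have e2 : lam R j * inner (trig (~~ c) j) (trig (~~ d) k) =
            par c * par d * lam R k * inner (trig c j) (trig d k).
    have : par c * (- par c * lam R j * inner (trig (~~ c) j) (trig (~~ d) k)) =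
      par c * (- par d * lam R k * inner (trig c j) (trig d k)) by rewrite h2.
    move=> h3; apply: oppr_inj; rewrite -[lam R j]mul1r -p1.
    by transitivity (par c * (- par c * lam R j * inner (trig (~~ c) j) (trig (~~ d) k))); [ring|rewrite h3; ring].
  rewrite mulrBl expr2 -mulrA e1 mulrCA mulrA.
  rewrite (_ : _ * inner (trig (~~ c) j) _ = par c * par d * lam R k * (lam R j * inner (trig (~~ c) j) (trig (~~ d) k))); last by ring.
  rewrite e2.
  rewrite (_ : par c * par d * lam R k * (par c * par d * lam R k * inner (trig c j) (trig d k)) = (par c * par c) * (par d * par d) * lam R k ^+ 2 * inner (trig c j) (trig d k)); last by ring.
  by rewrite p1 p2 !mul1r subrr.
rewrite andbT.
(* For equal indices the shift shows that the sine and the cosine have the same square norm; the two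
   add up to the integral of 1, which is 2 pi. *)
have [<-|cd] := eqVneq c d.
  have h := inner_trig_swap c (~~ c) k k.
  rewrite negbK parN opprK in h.
  have pc0 : par c * lam R k != 0 by rewrite mulf_neq0// -normr_eq0 norm_par oner_eq0.
  have {}h := mulfI pc0 h.
  apply: (mulIf (_ : 2%:R != 0 :> R)); first by rewrite pnatr_eq0.
  rewrite mulr_natr mulr2n {2}h /inner -RintD; last 2 first.
  - by apply/within_continuous_integrable/within_continuousM; exact: within_continuous_trig.
  - by apply/within_continuous_integrable/within_continuousM; exact: within_continuous_trig.
  rewrite (eq_Rint _ _ _ (fun=> 1)); last first.
    by move=> x _; rewrite /trig; case: c {h pc0} => /=; rewrite -!expr2 ?cos2Dsin2// addrC cos2Dsin2.
  by rewrite Rint_cst ?oppr_pi_le// mul1r opprK mulr_natr mulr2n.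
(* For a sine against a cosine of the same frequency the shift says that the inner product is its
   own opposite. *)
have dE : d = ~~ c by case: c d cd => -[].
rewrite dE.
have h := inner_trig_swap (~~ c) (~~ c) k k.
rewrite negbK parN opprK in h.
have sym : inner (trig (~~ c) k) (trig c k) = inner (trig c k) (trig (~~ c) k).
  by apply: eq_Rint => x _; rewrite mulrC.
rewrite sym in h.
have pc0 : par c * lam R k != 0 by rewrite mulf_neq0// -normr_eq0 norm_par oner_eq0.
move: h; rewrite !mulNr => /eqP; rewrite -subr_eq0 opprK -mulr2n mulrn_eq0 /=.
by rewrite mulf_eq0 (negbTE pc0) => /eqP.
Qed.

End TrigonometricSystem.

(** * Bessel's inequality and summability of the coefficients *)

Section Bessel.
Context {R : realType}.
Implicit Types (c d : bool) (j k n : nat) (x : R) (f g p e : R -> R).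

Let int_trigM c k g : mu.-integrable `[- pi, pi] (EFin \o g) ->
  mu.-integrable `[- pi, pi] (EFin \o (fun x => g x * trig c k x)).
Proof.
move=> ig; apply: integrable_mul_continuous ig _; first exact: oppr_pi_le.
exact: within_continuous_trig.
Qed.

Lemma in_L2_integrable_sqr p : in_L2 (- pi) pi p ->
  mu.-integrable `[- pi, pi] (EFin \o (fun x => p x * p x)).
Proof.
move=> [mp fp]; apply/integrableP; split.
  by apply/measurable_realfun.measurable_EFinP; exact: measurable_realfun.measurable_funM.
apply: le_lt_trans fp; rewrite le_eqVlt; apply/orP; left; apply/eqP.
by apply: eq_integral => x _; rewrite /= ger0_norm ?expr2// -expr2 sqr_ge0.
Qed.

(** On a bounded interval |p| <= 1 + p^2 is an integrable majorant. *)
Lemma in_L2_integrable p : in_L2 (- pi) pi p -> mu.-integrable `[- pi, pi] (EFin \o p).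
Proof.
move=> L; have ip2 := in_L2_integrable_sqr _ L; have [mp _] := L.
have i1 : mu.-integrable `[- pi, pi] (EFin \o (fun x => 1 + p x * p x)).
  have i1 := within_continuous_integrable _ _ _ (within_continuous_cst `[- pi, pi] (1 : R)).
  exact: (integrableD _ i1 ip2).
apply: le_integrable i1 => //.
  exact/measurable_realfun.measurable_EFinP.
move=> x _; rewrite /= lee_fin [leRHS]ger0_norm; last by rewrite addr_ge0// -expr2 sqr_ge0.
have : `|p x| * `|p x| = p x * p x by rewrite -normrM ger0_norm// -expr2 sqr_ge0.
move=> <-.
have := sqr_ge0 (`|p x| - 1); have := normr_ge0 (p x); nra.
Qed.

(** [r] is [g] minus its projection on the first [n] functions of the family, whose square norm is
    pi. The last clause lets the next projection coefficient be computed from [g] instead of [r]. *)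
Let proj_sub n g c : mu.-integrable `[- pi, pi] (EFin \o g) ->
  mu.-integrable `[- pi, pi] (EFin \o (fun x => g x * g x)) ->
  exists r, [/\ mu.-integrable `[- pi, pi] (EFin \o r),
    mu.-integrable `[- pi, pi] (EFin \o (fun x => r x * r x)),
    inner r r = inner g g - pi^-1 * \sum_(k < n) (inner g (trig c k)) ^+ 2 &
    forall m, (n <= m)%N -> inner r (trig c m) = inner g (trig c m)].
Proof.
move=> ig ig2; elim: n => [|n [r [ir ir2 rr rm]]].
  by exists g; split => //; rewrite big_ord0 mulr0 subr0.
pose a := pi^-1 * inner g (trig c n).
have ire := int_trigM c n r ir.
have ie := within_continuous_integrable _ _ _ (within_continuous_trig (- pi : R) pi c n).
have iee m : mu.-integrable `[- pi, pi] (EFin \o (fun x => trig c n x * trig c m x)).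
  exact: int_trigM ie.
have Z h : mu.-integrable `[- pi, pi] (EFin \o h) -> forall z, mu.-integrable `[- pi, pi] (EFin \o (fun x => z * h x)).
  by move=> ih z; exact: (integrableZl _ z ih).
have B h1 h2 : mu.-integrable `[- pi, pi] (EFin \o h1) -> mu.-integrable `[- pi, pi] (EFin \o h2) ->
    mu.-integrable `[- pi, pi] (EFin \o (fun x => h1 x - h2 x)).
  by move=> i1 i2; exact: (integrableB _ i1 i2).
have D h1 h2 : mu.-integrable `[- pi, pi] (EFin \o h1) -> mu.-integrable `[- pi, pi] (EFin \o h2) ->
    mu.-integrable `[- pi, pi] (EFin \o (fun x => h1 x + h2 x)).
  by move=> i1 i2; exact: (integrableD _ i1 i2).
have sqE : (fun x => (r x - a * trig c n x) * (r x - a * trig c n x)) =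
    (fun x => (r x * r x - (a *+ 2) * (r x * trig c n x)) + (a ^+ 2) * (trig c n x * trig c n x)).
  by apply/funext => x; rewrite mulr2n expr2; ring.
exists (fun x => r x - a * trig c n x); split.
- exact/B/Z.
- rewrite sqE; apply: D; last exact/Z/iee.
  exact/B/Z.
- rewrite {1}/inner sqE RintD; [|by apply/B => //; exact/Z|exact/Z/iee].
  rewrite RintB//; last exact/Z.
  rewrite RintZ// RintZ; last exact: iee.
  rewrite -!/(inner _ _) inner_trig !eqxx /= rm// rr big_ord_recr/=.
  have := lt0r_neq0 (pi_gt0 R); rewrite /a mulr2n.
  by move: pi (inner g g) (inner g _) (\sum_(_ < _) _) => w u v s w0; field.
- move=> m nm; rewrite /inner.
  rewrite (eq_Rint _ _ _ (fun x => r x * trig c m x - a * (trig c n x * trig c m x))); last first.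
    by move=> x _; rewrite mulrBl mulrA.
  rewrite RintB; [|exact: int_trigM|exact/Z/iee].
  rewrite RintZ; last exact: iee.
  rewrite -!/(inner _ _) inner_trig eqxx /= ltn_eqF// mulr0 subr0 rm//.
  exact: ltnW.
Qed.

Lemma bessel_inequality p c n : in_L2 (- pi) pi p ->
  \sum_(k < n) (inner p (trig c k)) ^+ 2 <= pi * inner p p.
Proof.
move=> L; have [r [_ _ rr _]] := proj_sub n p c (in_L2_integrable _ L) (in_L2_integrable_sqr _ L).
have : 0 <= inner r r by apply: Rintegral_ge0 => x _; rewrite -expr2 sqr_ge0.
by rewrite rr subr_ge0 ler_pdivrMl// pi_gt0.
Qed.

Lemma cvg_series_bounded_ge0 (u : nat -> R) (B : R) : (forall k, 0 <= u k) ->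
  (forall n, \sum_(k < n) u k <= B) -> cvgn (series u).
Proof.
move=> u0 uB; apply: nondecreasing_is_cvgn; first exact: nondecreasing_series.
by exists B => _ [n _ <-]; rewrite /series /= big_mkord.
Qed.

(** The term k = 0 is 4, and the others telescope: (t + 1/2)^2 exceeds t (t + 1) by 1/4, so (t +
    1/2)^-2 <= 1/t - 1/(t + 1). Hence the bound 5 - 1/(m + 1). *)
Lemma cvg_series_lamV2 : cvgn (series (fun k => (lam R k) ^- 2)).
Proof.
apply: (cvg_series_bounded_ge0 _ 5) => [k|n].
  by rewrite invr_ge0 exprn_ge0// ltW// lam_gt0.
suff H m : \sum_(k < m.+1) (lam R k) ^- 2 <= 5 - (m.+1)%:R^-1.
  case: n => [|n]; first by rewrite big_ord0.
  by apply: le_trans (H n) _; rewrite gerBl invr_ge0.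
elim: m => [|m IH].
  rewrite big_ord_recr big_ord0 /= /lam add0r add0r invr1 -exprVn invrK; lra.
rewrite big_ord_recr /=; apply: le_trans (lerD IH (lexx _)) _.
have -> : lam R m.+1 = (m.+1)%:R + 2^-1 by [].
have -> : (m.+2)%:R = (m.+1)%:R + 1 :> R by rewrite natr1.
set t : R := (m.+1)%:R.
have t0 : 0 < t by rewrite ltr0n.
have t1 : 0 < t + 1 by lra.
have t2 : 0 < t + 2^-1 by lra.
rewrite -subr_ge0.
have -> : 5 - (t + 1)^-1 - (5 - t^-1 + (t + 2^-1) ^- 2) =
  ((4 * t * (t + 1)) * (t + 2^-1) ^+ 2)^-1.
  by field; rewrite !gt_eqF//; lra.
by rewrite invr_ge0 ltW// !mulr_gt0// exprn_gt0.
Qed.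

(** The inequality u v <= u^2 + v^2 with v = 1 / [lam] stands in for Cauchy-Schwarz. *)
Lemma bessel_summable p c : in_L2 (- pi) pi p ->
  cvgn (series (fun k => `|inner p (trig c k)| / lam R k)).
Proof.
move=> L.
have c1 : cvgn (series (fun k => inner p (trig c k) ^+ 2)).
  apply: (cvg_series_bounded_ge0 _ (pi * inner p p)) => [k|n]; first exact: sqr_ge0.
  exact: bessel_inequality.
apply: (series_le_cvg _ _ _ (is_cvg_seriesD c1 cvg_series_lamV2)) => n.
- by rewrite divr_ge0// ltW// lam_gt0.
- by rewrite addr_ge0 ?sqr_ge0// invr_ge0 exprn_ge0// ltW// lam_gt0.
- have -> : ((fun k => inner p (trig c k) ^+ 2) + (fun k => (lam R k) ^- 2)) n =
    `|inner p (trig c n)| ^+ 2 + (lam R n)^-1 ^+ 2.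
    by rewrite /= real_normK ?num_real// exprVn.
  have l0 : 0 <= (lam R n)^-1 by rewrite invr_ge0 ltW// lam_gt0.
  have := normr_ge0 (inner p (trig c n)).
  move: (`|_|) ((lam R n)^-1) l0 => u v v0 u0; have := sqr_ge0 (u - v); nra.
Qed.

End Bessel.

(** * Completeness of the antiperiodic system *)

Section Completeness.
Context {R : realType}.
Implicit Types (c d : bool) (j k n : nat) (x y : R) (f g : R -> R).

Lemma Rint_ge (a b : R) f (m : R) : a <= b ->
  mu.-integrable `[a, b] (EFin \o f) ->
  (forall x, a <= x <= b -> m <= f x) -> m * (b - a) <= Rint a b f.
Proof.
move=> ab fi mf; rewrite -Rint_cst//; apply: le_Rintegral => //.
exact/within_continuous_integrable/within_continuous_cst.
Qed.

Lemma ler_cos x y : 0 <= x -> x <= y -> y <= pi -> cos y <= cos x.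
Proof.
move=> x0 xy ypi; rewrite leNgt ltr_cos ?in_itv/= ?x0 ?ypi ?(le_trans xy) ?(le_trans x0)//.
by rewrite -leNgt.
Qed.

(** With y = x - x0, cos(y/2)^2 cos(l y) is cos(l y)/2 + cos((l + 1) y)/4 + cos((l - 1) y)/4, so
    each square lowers [n] by one and moves [k] by at most one. The case k = 0 is the odd power
    cos(y/2)^(2n+1). *)
Lemma inner_cos_power g x0 n k : {within `[- pi, pi], continuous g} ->
  (forall c k, inner g (trig c k) = 0) ->
  inner g (fun x => cos ((x - x0) / 2) ^+ n.*2 * cos (lam R k * (x - x0))) = 0.
Proof.
move=> cg g0.
have ccos (z : R) : continuous (fun x : R => cos (z * (x - x0))).
  move=> x; apply: (@continuous_comp _ _ _ (fun x => z * (x - x0)) cos); last exact: continuous_cos.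
  by apply: cvgM; [exact: cvg_cst|apply: cvgB; [exact: cvg_id|exact: cvg_cst]].
have ccosp (m : nat) : continuous (fun x : R => cos ((x - x0) / 2) ^+ m).
  move=> x; apply: (@continuous_comp _ _ _ (fun x => cos ((x - x0) / 2)) (fun z => z ^+ m)).
    apply: (@continuous_comp _ _ _ (fun x => (x - x0) / 2) cos); last exact: continuous_cos.
    by apply: cvgM; [apply: cvgB; [exact: cvg_id|exact: cvg_cst]|exact: cvg_cst].
  exact: exprn_continuous.
have ig m z : mu.-integrable `[- pi, pi]
    (EFin \o (fun x => g x * (cos ((x - x0) / 2) ^+ m * cos (z * (x - x0))))).
  apply/within_continuous_integrable/within_continuousM => //.
  by apply: within_continuousM; exact/within_continuousT.
elim: n k => [|n IH] k.
  transitivity (inner g (fun x => cos (lam R k * x0) * trig true k x +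
      sin (lam R k * x0) * trig false k x)).
    by apply: eq_Rint => x _; rewrite double0 expr0 mul1r mulrBr cosB /trig; ring.
  transitivity (cos (lam R k * x0) * inner g (trig true k) +
     sin (lam R k * x0) * inner g (trig false k)); last by rewrite !g0 !mulr0 addr0.
  have ik c : mu.-integrable `[- pi, pi] (EFin \o (fun x => g x * trig c k x)).
    by apply/within_continuous_integrable/within_continuousM => //; exact: within_continuous_trig.
  rewrite /inner -!RintZ// -RintD; [|exact: (integrableZl _ _ (ik _))..].
  by apply: eq_Rint => x _; ring.
pose I (z : R) := inner g (fun x => cos ((x - x0) / 2) ^+ n.*2 * cos (z * (x - x0))).
have I0 z : I (- z) = I z.
  by apply: eq_Rint => x _; rewrite mulNr cosN.
transitivity (2^-1 * I (lam R k) + (4^-1 * I (lam R k.+1) + 4^-1 * I (lam R k - 1))).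
  have iI z : mu.-integrable `[- pi, pi] (EFin \o (fun x => 4^-1 * (g x * (cos ((x - x0) / 2) ^+ n.*2 * cos (z * (x - x0)))))).
    exact: (integrableZl _ _ (ig _ _)).
  have iI2 z : mu.-integrable `[- pi, pi] (EFin \o (fun x => 2^-1 * (g x * (cos ((x - x0) / 2) ^+ n.*2 * cos (z * (x - x0)))))).
    exact: (integrableZl _ _ (ig _ _)).
  rewrite /I /inner -!RintZ// -[X in _ + X]RintD// -RintD//; last first.
    exact: (integrableD _ (iI _) (iI _)).
  apply: eq_Rint => x _.
  have -> : cos ((x - x0) / 2) ^+ n.+1.*2 = cos ((x - x0) / 2) ^+ n.*2 * cos ((x - x0) / 2) ^+ 2.
    by rewrite -(exprD _ n.*2 2) doubleS addn2.
  have -> : lam R k.+1 = lam R k + 1 by rewrite /lam -natr1 addrAC.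
  have -> : (lam R k + 1) * (x - x0) = lam R k * (x - x0) + (x - x0) by ring.
  have -> : (lam R k - 1) * (x - x0) = lam R k * (x - x0) - (x - x0) by ring.
  rewrite cosB (cosD (lam R k * (x - x0))).
  have -> : cos (x - x0) = 2 * cos ((x - x0) / 2) ^+ 2 - 1.
    have h := cos_mulr2n ((x - x0) / 2).
    by rewrite mulr_natl -h -(mulr_natr ((x - x0) / 2)) divfK// pnatr_eq0.
  by field.
have Ik m : I (lam R m) = 0 by exact: IH.
(* At k = 0 the lower neighbour is the frequency - 1/2, which evenness of the cosine folds back to
   1/2. *)
rewrite !Ik; case: k => [|k].
  have -> : lam R 0 - 1 = - lam R 0 by rewrite /lam; field.
  by rewrite I0 Ik !mulr0 !addr0.
have -> : lam R k.+1 - 1 = lam R k by rewrite /lam -natr1; ring.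
by rewrite Ik !mulr0 !addr0.
Qed.

(* A positive value g x0 is detected by the odd powers of cos((x - x0)/2),
   which peak at x0 and are antiperiodic trigonometric polynomials. *)
Let trig_complete_le0 g x0 : {within `[- pi, pi], continuous g} ->
  (forall c k, inner g (trig c k) = 0) -> - pi < x0 < pi -> g x0 <= 0.
Proof.
move=> cg g0 /andP[x0l x0r]; rewrite leNgt; apply/negP => gx0.
have pp := pi_gt0 R.
have cgx0 : {for x0, continuous g}.
  have := (continuous_within_itvP _ (oppr_pi_lt)).1 cg.
  by move=> [h _ _]; apply: h; rewrite in_itv/= x0l x0r.
have : \forall x \near x0, g x0 / 2 < g x.
  by apply: (cvgr_gt (g x0) cgx0); rewrite ltr_pdivrMr// mulr_natr mulr2n ltrDl.
move=> [r0 /= r00 Hr0].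
have ax0 : `|x0| < pi by rewrite ltr_norml x0l x0r.
(* The first bound keeps [g] above [g x0 / 2] within distance [dl] of [x0]. The second keeps that
   neighbourhood inside the interval and |x - x0| / 2 at most pi - dl/2, away from the other peak of
   the absolute value of the kernel. *)
pose dl := Num.min (r0 / 2) ((pi - `|x0|) / 2).
have dl0 : 0 < dl by rewrite lt_min !divr_gt0// subr_gt0.
have dl1 : dl <= r0 / 2 by rewrite ge_min lexx.
have dl2 : dl <= (pi - `|x0|) / 2 by rewrite ge_min lexx orbT.
have dlr : dl < r0 by lra.
have dlp : dl <= pi - `|x0| by lra.
have x0n := ler_norm x0; have x0n' : - x0 <= `|x0| by rewrite -normrN ler_norm.
have ax00 := normr_ge0 x0.
have gd x : `|x - x0| <= dl -> g x0 / 2 <= g x.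
  by move=> h; apply/ltW/Hr0; rewrite /= distrC (le_lt_trans h).
have [M M0 gM] := within_continuous_bounded _ _ _ oppr_pi_le cg.
(* [q] bounds |cos((x - x0)/2)| beyond distance [dl], while [r] is a lower bound of the cosine
   within distance dl/2; the gap q < r decides the argument. *)
pose q := cos (dl / 2); pose r := cos (dl / 4).
have q0 : 0 < q.
  by apply: cos_gt0_pihalf; apply/andP; split; lra.
have qr : q < r.
  by rewrite /q /r ltr_cos ?in_itv/=; [|apply/andP; split|apply/andP; split]; lra.
have r0' : 0 < r by exact: lt_trans qr.
pose K n x := cos ((x - x0) / 2) ^+ n.*2.+1.
have cK n : continuous (K n).
  move=> x; apply: (@continuous_comp _ _ _ (fun x => cos ((x - x0) / 2)) (fun z => z ^+ _)).
    apply: (@continuous_comp _ _ _ (fun x => (x - x0) / 2) cos); last exact: continuous_cos.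
    by apply: cvgM; [apply: cvgB; [exact: cvg_id|exact: cvg_cst]|exact: cvg_cst].
  exact: exprn_continuous.
have cgK n : {within `[- pi, pi], continuous (fun x => g x * K n x)}.
  by apply: within_continuousM => //; exact/within_continuousT.
have igK n a b : - pi <= a -> b <= pi ->
    mu.-integrable `[a, b] (EFin \o (fun x => g x * K n x)).
  move=> ha hb; apply: integrableS (within_continuous_integrable _ _ _ (cgK n)) => //.
  by apply: subset_itv; rewrite bnd_simp.
have gK0 n : Rint (- pi) pi (fun x => g x * K n x) = 0.
  rewrite -(inner_cos_power g x0 n 0 cg g0); apply: eq_Rint => x _.
  by rewrite /K exprSr /lam add0r (mulrC 2^-1).
have cosN' x : cos ((x - x0) / 2) = cos (`|x - x0| / 2).
  by rewrite -(cos_norm ((x - x0) / 2)) normrM (@ger0_norm _ 2^-1)// invr_ge0.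
have far n x : - pi <= x <= pi -> dl / 2 <= `|x - x0| -> - (M * q ^+ n.*2.+1) <= g x * K n x.
  move=> xpi far; have /andP[xl xr] := xpi.
  have xx0 : `|x - x0| <= pi + `|x0|.
    by rewrite ler_norml; apply/andP; split; lra.
  (* Between dl/2 and [dl] both [g] and the kernel are nonnegative, so this zone cannot hurt; beyond
     [dl] the integrand is small in absolute value. *)
  have [dx|dx] := leP `|x - x0| dl.
    apply: (@le_trans _ _ 0); first by rewrite oppr_le0 mulr_ge0// ?exprn_ge0// ltW.
    apply: mulr_ge0; first by apply: le_trans (gd _ dx); rewrite divr_ge0// ltW.
    rewrite /K cosN' exprn_ge0//; apply: cos_ge0_pihalf; apply/andP; split; lra.
  have cq : `|cos ((x - x0) / 2)| <= q.
    rewrite cosN' ler_norml; apply/andP; split; last by apply: ler_cos; lra.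
    have -> : - q = cos (pi - dl / 2) by rewrite /q addrC cosDpi cosN.
    by apply: ler_cos; lra.
  rewrite lerNl -mulNr; apply: le_trans (ler_norm _) _.
  rewrite normrM normrN ler_pM ?gM// /K normrX lerXn2r// ?nnegrE ?normr_ge0// ltW//.
have near' n x : `|x - x0| <= dl / 2 -> g x0 / 2 * r ^+ n.*2.+1 <= g x * K n x.
  move=> nr; apply: ler_pM.
  - by rewrite divr_ge0// ltW.
  - by rewrite exprn_ge0// ltW.
  - by apply: gd; apply: le_trans nr _; lra.
  - have hc : r <= cos ((x - x0) / 2) by rewrite cosN' /r; apply: ler_cos; have := normr_ge0 (x - x0); lra.
    rewrite /K lerXn2r// ?nnegrE; first exact: ltW.
    by apply: le_trans hc; exact: ltW.
(* The whole integral is 0, so the positive mass gained on the central interval of length [dl] is at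
   most what the rest can cancel. *)
have main n : g x0 / 2 * r ^+ n.*2.+1 * dl <= M * q ^+ n.*2.+1 * (pi + pi).
  pose a := x0 - dl / 2; pose b := x0 + dl / 2.
  have la : - pi <= a by rewrite /a; lra.
  have ab : a <= b by rewrite /a /b; lra.
  have bl : b <= pi by rewrite /b; lra.
  have s := gK0 n.
  rewrite (Rint_split (- pi) a pi) in s; [|exact: la|lra|exact: igK].
  rewrite (Rint_split a b pi) in s; [|exact: ab|lra|exact: igK].
  have h1 := Rint_ge (- pi) a (fun x => g x * K n x) (- (M * q ^+ n.*2.+1)) la (igK _ _ _ (lexx _) (le_trans ab bl)).
  have f1 x : - pi <= x <= a -> - (M * q ^+ n.*2.+1) <= g x * K n x.
    move=> /andP[xl xa]; apply: far; first by rewrite xl (le_trans xa (le_trans ab bl)).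
    by rewrite distrC; apply: le_trans (ler_norm _); rewrite /a in xa; lra.
  have {}h1 := h1 f1.
  have h2 := Rint_ge a b (fun x => g x * K n x) (g x0 / 2 * r ^+ n.*2.+1) ab (igK _ _ _ la bl).
  have f2 x : a <= x <= b -> g x0 / 2 * r ^+ n.*2.+1 <= g x * K n x.
    move=> /andP[xa xb]; apply: near'; rewrite ler_norml.
    by rewrite /a in xa; rewrite /b in xb; apply/andP; split; lra.
  have {}h2 := h2 f2.
  have h3 := Rint_ge b pi (fun x => g x * K n x) (- (M * q ^+ n.*2.+1)) bl (igK _ _ _ (le_trans la ab) (lexx _)).
  have f3 x : b <= x <= pi -> - (M * q ^+ n.*2.+1) <= g x * K n x.
    move=> /andP[xb xr]; apply: far; first by rewrite xr (le_trans (le_trans la ab) xb).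
    by apply: le_trans (ler_norm _); rewrite /b in xb; lra.
  have {}h3 := h3 f3.
  have Mq : 0 <= M * q ^+ n.*2.+1 by rewrite mulr_ge0 ?exprn_ge0// ltW.
  have ba : b - a = dl by rewrite /a /b; field.
  rewrite ba in h2.
  have : M * q ^+ n.*2.+1 * ((a + pi) + (pi - b)) <= M * q ^+ n.*2.+1 * (pi + pi).
    by rewrite ler_wpM2l//; lra.
  move: (M * q ^+ n.*2.+1) (g x0 / 2 * r ^+ n.*2.+1 * dl) h1 h2 h3 Mq s => u v h1 h2 h3 Mq s.
  lra.
have qr1 : `|q / r| < 1 by rewrite gtr0_norm ?divr_gt0// ltr_pdivrMr// mul1r.
(* By [main] every odd power of q / r is at least [e], yet these powers tend to 0. *)
pose e := g x0 / 2 * dl / (M * (pi + pi)).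
have e0 : 0 < e by rewrite divr_gt0// !mulr_gt0// ?divr_gt0// addr_gt0.
have [n _ /(_ n (leqnn n))] := (cvgrPdist_lt _ _).1 (cvg_expr qr1) _ e0.
rewrite /= sub0r normrN ger0_norm ?exprn_ge0 ?divr_ge0 ?ltW// => hn.
have hn' : (q / r) ^+ n.*2.+1 < e.
  apply: le_lt_trans hn; rewrite -addnn -addSn exprD.
  have qr0 : 0 <= q / r by rewrite divr_ge0 ?ltW.
  have qrle : q / r <= 1 by rewrite ltW// ltr_pdivrMr// mul1r.
  by apply: ler_piMl; [exact: exprn_ge0|exact: exprn_ile1].
have rN : 0 < r ^+ n.*2.+1 by rewrite exprn_gt0.
move: hn'; rewrite expr_div_n ltr_pdivrMr// /e mulrAC ltr_pdivlMr; last by rewrite mulr_gt0// addr_gt0.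
have := main n; move: (q ^+ _) (r ^+ _) => u v; lra.
Qed.

Lemma within_continuous_interior_eq (a b : R) f g : a < b ->
  {within `[a, b], continuous f} -> {within `[a, b], continuous g} ->
  (forall x, a < x < b -> f x = g x) -> forall x, a <= x <= b -> f x = g x.
Proof.
move=> ab cf cg fg x /andP[].
have [ci ca cb] := (continuous_within_itvP _ ab).1 (within_continuousB _ _ _ cf cg).
rewrite le_eqVlt => /predU1P[<- _|ax].
  apply/eqP; rewrite -subr_eq0; apply/eqP.
  have h : (fun x => f x - g x) @ a^'+ --> (0 : R).
    apply: cvg_near_cst; near=> y.
    have ay : a < y by near: y; exact: nbhs_right_gt.
    have yb : y < b by near: y; exact: nbhs_right_lt.
    by rewrite fg ?ay ?yb// subrr.
  exact: (cvg_unique _ ca h).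
rewrite le_eqVlt => /predU1P[->|xb].
  apply/eqP; rewrite -subr_eq0; apply/eqP.
  have h : (fun x => f x - g x) @ b^'- --> (0 : R).
    apply: cvg_near_cst; near=> y.
    have yb : y < b by near: y; exact: nbhs_left_lt.
    have ay : a < y by near: y; exact: nbhs_left_gt.
    by rewrite fg ?ay ?yb// subrr.
  exact: (cvg_unique _ cb h).
by apply: fg; rewrite ax xb.
Unshelve. all: end_near. Qed.

(** The sign argument applies to g and - g at interior points; continuity takes the conclusion to
    the endpoints. *)
Lemma trig_complete g : {within `[- pi, pi], continuous g} ->
  (forall c k, inner g (trig c k) = 0) -> forall x, - pi <= x <= pi -> g x = 0.
Proof.
move=> cg g0; apply: (within_continuous_interior_eq _ _ _ _ oppr_pi_lt cg (within_continuous_cst _ 0)).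
move=> x xpi; apply/eqP; rewrite eq_le; apply/andP; split; first exact: trig_complete_le0.
rewrite -oppr_le0.
apply: (trig_complete_le0 (fun x => - g x)) => //.
  by move=> z; apply: continuousN; exact: cg.
move=> c k.
have ik : mu.-integrable `[- pi, pi] (EFin \o (fun x => g x * trig c k x)).
  by apply/within_continuous_integrable/within_continuousM => //; exact: within_continuous_trig.
rewrite -[RHS](mulr0 (-1)) -(g0 c k) /inner -RintZ//.
by apply: eq_Rint => y _; rewrite mulN1r mulNr.
Qed.

End Completeness.

(** * Expansion in an absolutely convergent antiperiodic series *)

Section FourierExpansion.
Context {R : realType}.
Implicit Types (c d : bool) (j k m n : nat) (x : R) (f g : R -> R) (al : nat -> R).

Lemma abs_cvg_trig_series al c x : cvgn (series (fun k => `|al k|)) ->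
  series_cvg (fun k => al k * trig c k x).
Proof.
move=> cal; apply: (dominated_cvg_series _ _ cal) => k.
by rewrite normrM ler_piMr// trig_le1.
Qed.

Lemma continuous_trig_series al c : cvgn (series (fun k => `|al k|)) ->
  continuous (fun x => series_sum (fun k => al k * trig c k x)).
Proof.
move=> cal x; apply: (tannery (nbhs x) _ _ _ cal).
  by apply: nearW => y k; rewrite normrM ler_piMr// trig_le1.
by move=> k; apply: cvgM; [exact: cvg_cst|exact: continuous_trig].
Qed.

(** Absolute summability makes the partial sums converge uniformly, so the inner product is the
    limit of those of the partial sums, which no longer change once the term m is included. *)
Lemma inner_trig_series al c d m : cvgn (series (fun k => `|al k|)) ->
  inner (fun x => series_sum (fun k => al k * trig c k x)) (trig d m) =
  if c == d then pi * al m else 0.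
Proof.
move=> cal; set S := fun x => _.
have cS := continuous_trig_series al c cal; rewrite -/S in cS.
pose P n x := series (fun k => al k * trig c k x) n.
have cP n : {within `[- pi, pi], continuous (P n)}.
  elim: n => [|n IH].
    rewrite (_ : P 0%N = fun=> 0); first exact: within_continuous_cst.
    by apply/funext => x; rewrite /P /series /= big_geq.
  rewrite (_ : P n.+1 = fun x => P n x + al n * trig c n x).
    apply: within_continuousD => //; apply: within_continuousM; first exact: within_continuous_cst.
    exact: within_continuous_trig.
  by apply/funext => x; rewrite /P seriesSr.
have ct := within_continuous_trig (- pi : R) pi d m.
have iP n : (m < n)%N -> inner (P n) (trig d m) = if c == d then pi * al m else 0.
  have H k : inner (P k) (trig d m) = \sum_(j < k) al j * inner (trig c j) (trig d m).
    elim: k => [|k IH].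
      rewrite big_ord0 /inner (eq_Rint _ _ _ (fun=> 0)).
        by rewrite Rint_cst ?mul0r// oppr_pi_le.
      by move=> x _; rewrite /P /series /= big_geq// mul0r.
    rewrite big_ord_recr -IH /= /inner -RintZ; last first.
      by apply/within_continuous_integrable/within_continuousM => //; exact: within_continuous_trig.
    rewrite -RintD; last 2 first.
      by apply/within_continuous_integrable/within_continuousM.
      apply/within_continuous_integrable/within_continuousM; first exact: within_continuous_cst.
      by apply/within_continuousM => //; exact: within_continuous_trig.
    by apply: eq_Rint => x _; rewrite /P seriesSr mulrDl mulrA.
  move=> mn; rewrite H (bigD1 (Ordinal mn))//= big1 ?addr0.
    by rewrite inner_trig eqxx andbT; case: ifP => _; rewrite ?mulr0// mulrC.
  move=> j /eqP jm; rewrite inner_trig; case: (altP (j =P m :> nat)) => [jm'|_].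
    by exfalso; apply: jm; apply: val_inj.
  by rewrite andbF mulr0.
apply/eqP; rewrite -subr_eq0 -normr_le0; apply/ler_addgt0Pr => e e0; rewrite add0r.
have e2 : 0 < e / (2 * pi) by rewrite divr_gt0// mulr_gt0// pi_gt0.
have [N _ HN] := (cvgrPdist_lt _ _).1 cal _ e2.
(* Far enough for the tail to be small and for the partial sum to contain the term m. *)
pose n := maxn N m.+1.
have {}HN := HN n (leq_maxl _ _); rewrite /= in HN.
rewrite -(iP n (leq_maxr _ _)) /inner -RintB; last 2 first.
  by apply/within_continuous_integrable/within_continuousM => //; exact: within_continuousT.
  by apply/within_continuous_integrable/within_continuousM.
rewrite (eq_Rint _ _ _ (fun x => (S x - P n x) * trig d m x)); last by move=> x _; rewrite mulrBl.
have -> : e = e / (2 * pi) * (pi - - pi).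
  by rewrite opprK -mulr2n -(mulr_natl pi) divfK// mulf_neq0// gt_eqF// pi_gt0.
apply: Rint_norm_le; first exact: oppr_pi_le.
  apply/within_continuous_integrable/within_continuousM => //.
  by apply: within_continuousB => //; exact: within_continuousT.
move=> x _; rewrite normrM -[leRHS]mulr1 ler_pM// ?trig_le1//.
apply: le_trans (ltW HN); apply: le_trans (ler_norm _).
apply: (series_tail_le _ _ n cal) => k.
by rewrite normrM ler_piMr// trig_le1.
Qed.

(** [g] and the two series have the same coefficients, and completeness concludes. No boundary
    condition is imposed on [g]: this matters for the source f, of which only continuity is
    known. *)
Theorem fourier_expansion g (al : bool -> nat -> R) :
  {within `[- pi, pi], continuous g} ->
  (forall c k, inner g (trig c k) = pi * al c k) ->
  (forall c, cvgn (series (fun k => `|al c k|))) ->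
  forall x, - pi <= x <= pi ->
    g x = series_sum (fun k => al true k * trig true k x)
        + series_sum (fun k => al false k * trig false k x).
Proof.
move=> cg gal cal x xpi.
pose S c x := series_sum (fun k => al c k * trig c k x).
have cS c : {within `[- pi, pi], continuous (S c)}.
  by apply: within_continuousT; exact: continuous_trig_series.
apply/eqP; rewrite -subr_eq0; apply/eqP.
apply: (trig_complete (fun x => g x - (S true x + S false x)) _ _ x xpi).
  by apply: within_continuousB => //; exact: within_continuousD.
move=> c k.
have i f : {within `[- pi, pi], continuous f} -> mu.-integrable `[- pi, pi] (EFin \o (fun x => f x * trig c k x)).
  by move=> cf; apply/within_continuous_integrable/within_continuousM => //; exact: within_continuous_trig.
transitivity (inner g (trig c k) - (inner (S true) (trig c k) + inner (S false) (trig c k))).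
  rewrite /inner -RintD; [|exact: i..]; rewrite -RintB; last 2 first.
    exact: i.
    by rewrite (_ : (fun x => _) = (fun x => (S true x + S false x) * trig c k x));
     [exact/i/within_continuousD|apply/funext => y; rewrite mulrDl].
  by apply: eq_Rint => y _; rewrite mulrBl mulrDl.
rewrite gal !inner_trig_series//.
by case: c {i} => /=; rewrite ?addr0 ?add0r subrr.
Qed.

End FourierExpansion.

(** * Evolution of the Fourier modes of a solution *)

Section Compactness.
Context {R : realType}.

Lemma continuous_pairl {X Y : topologicalType} (y : Y) : continuous (fun x : X => (x, y)).
Proof.
move=> x P [[A B] /= [xA yB] AB]; move: xA; apply: filterS => z Az.
by apply: (AB (z, y)); split => //; exact: nbhs_singleton yB.
Qed.

(** A tube argument: compactness of [a, b] makes the continuity in the second variable uniform in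
    the first. *)
Lemma near_uniform_section (a b c d s : R) (H : R * R -> R) (e : R) :
  {within `[a, b] `*` `[c, d], continuous H} -> c <= s <= d -> 0 < e ->
  \forall s' \near within `[c, d] (nbhs s), forall x, a <= x <= b ->
    `|H (x, s) - H (x, s')| < e.
Proof.
move=> /subspace_continuousP cH scd e0.
have e2 : 0 < e / 2 by rewrite divr_gt0.
have /compact_near_coveringP/near_covering_withinP cov := @segment_compact R a b.
have := cov _ (within `[c, d] (nbhs s)) (fun s' x => `|H (x, s) - H (x, s')| < e) _.
suff Hloc : forall x, `[a, b]%classic x -> \forall x' \near x & s' \near within `[c, d] (nbhs s),
    `[a, b]%classic x' -> `|H (x', s) - H (x', s')| < e.
  move=> /(_ _ Hloc); apply: filterS => s' h x xab; apply: h.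
  by rewrite /= in_itv.
move=> x xab.
have Kxs : (`[a, b] `*` `[c, d]) (x, s) by split => //=; rewrite in_itv.
have /cvgrPdist_lt /(_ _ e2) := cH _ Kxs.
rewrite near_withinE => -[[U V] /= [xU sV] UV].
exists (U, V `&` `[c, d]).
  split => //=; apply: filterI; last exact: withinT.
  exact: (cvg_within _ sV).
move=> [x' s'] /= [Ux' [Vs' s'cd]] x'ab.
have h1 := UV (x', s) (conj Ux' (nbhs_singleton sV)) (conj x'ab Kxs.2).
have h2 := UV (x', s') (conj Ux' Vs') (conj x'ab s'cd).
rewrite (_ : H (x', s) - H (x', s') = (H (x, s) - H (x', s')) - (H (x, s) - H (x', s))); last by ring.
apply: le_lt_trans (ler_normB _ _) _; rewrite (splitr e).
exact: ltrD.
Qed.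

Lemma rectangle_bounded (a b c d : R) (H : R * R -> R) :
  {in `[a, b] `*` `[c, d], continuous H} ->
  exists2 M : R, 0 < M & forall x t, a <= x <= b -> c <= t <= d -> `|H (x, t)| <= M.
Proof.
move=> cH.
have Kc : compact (`[a, b] `*` `[c, d] : set (R * R)%type).
  by apply: compact_setX; exact: segment_compact.
have := compact_bounded (continuous_compact (continuous_in_subspaceT cH) Kc).
move=> [M0 [_ HM]]; exists (`|M0| + 1); first by rewrite ltr_wpDl.
move=> x t xab tcd; apply: (HM (`|M0| + 1)).
  by rewrite (le_lt_trans (ler_norm _))// ltrDl.
by exists (x, t) => //; split; rewrite /= in_itv.
Qed.

Lemma continuous_Rint_section (a b c d : R) (H : R * R -> R) (e : R -> R) : a <= b ->
  {within `[a, b] `*` `[c, d], continuous H} -> continuous e ->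
  {within `[c, d], continuous (fun t => Rint a b (fun x => H (x, t) * e x))}.
Proof.
move=> ab cH ce.
have cHt t : c <= t <= d -> {within `[a, b], continuous (fun x => H (x, t))}.
  move=> tcd; apply: (within_continuous_comp _ _ H (fun x => (x, t)) cH).
    exact: continuous_pairl.
  by move=> x /= xab; split => //=; rewrite in_itv.
have [M M0 eM] := within_continuous_bounded _ _ _ ab (within_continuousT `[a, b] _ ce).
apply/subspace_continuousP => s /=; rewrite in_itv/= => scd.
apply/cvgrPdist_le => /= r r0.
(* The added 1 keeps the divisor positive when a = b. *)
have d0 : 0 < M * (b - a) + 1 by rewrite ltr_wpDl// mulr_ge0 ?subr_ge0// ltW.
have := near_uniform_section a b c d s H (r / (M * (b - a) + 1)) cH scd (divr_gt0 r0 d0).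
rewrite !near_withinE; apply: filterS => t h tcd; move: (tcd); rewrite /= in_itv/= => tcd'.
have {}h := h tcd.
have i t' : c <= t' <= d -> mu.-integrable `[a, b] (EFin \o (fun x => H (x, t') * e x)).
  move=> t'cd; apply/within_continuous_integrable/within_continuousM; first exact: cHt.
  exact: within_continuousT.
rewrite -RintB; [|exact: i..].
apply: (@le_trans _ _ (r / (M * (b - a) + 1) * M * (b - a))).
  apply: Rint_norm_le => //.
    apply/within_continuous_integrable/within_continuousB;
      by apply: within_continuousM; [exact: cHt|exact: within_continuousT].
  move=> x xab; rewrite -mulrBl normrM ler_pM//; first exact/ltW/h.
  exact: eM.
rewrite -mulrA mulrAC ler_pdivrMr//; apply: ler_wpM2l; first exact: ltW.
by rewrite lerDl.
Qed.

Lemma mean_value_le (G g : R -> R) (s t K : R) : s <= t ->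
  (forall x, s <= x <= t -> is_derive x 1 G (g x)) ->
  (forall x, s <= x <= t -> `|g x| <= K) -> `|G t - G s| <= K * (t - s).
Proof.
rewrite le_eqVlt => /predU1P[->|st] dG gK; first by rewrite !subrr normr0 mulr0.
have cG : {within `[s, t], continuous G}.
  apply: derivable_within_continuous => x; rewrite in_itv/= => xst.
  exact: (@ex_derive _ _ _ _ _ _ _ (dG x xst)).
have dG' x : x \in `]s, t[ -> is_derive x 1 G (g x).
  by rewrite in_itv/= => /andP[sx xt]; apply: dG; rewrite !ltW.
have [x] := MVT st dG' cG.
rewrite in_itv/= => /andP[sx xt] ->.
rewrite normrM (gtr0_norm (_ : 0 < t - s)) ?subr_gt0//.
apply: ler_wpM2r; first by rewrite subr_ge0 ltW.
by apply: gK; rewrite !ltW.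
Qed.

Lemma Rint_oppr (b : R) (h : R -> R) : 0 <= b -> {within `[- b, b], continuous h} ->
  Rint (- b) b (fun x => h (- x)) = Rint (- b) b h.
Proof.
move=> b0 ch; rewrite /Rint /Rintegral; congr fine.
have bb : - b <= b by rewrite (le_trans _ b0)// oppr_le0.
have := integration_by_substitution_oppr bb; rewrite opprK => H.
by have := H h ch => ->.
Qed.

Lemma Rint_oppr_trig (b : R) (h : R -> R) c k : 0 <= b -> {within `[- b, b], continuous h} ->
  Rint (- b) b (fun x => h (- x) * trig c k x) = par c * Rint (- b) b (fun x => h x * trig c k x).
Proof.
move=> b0 ch.
have che : {within `[- b, b], continuous (fun x => h x * trig c k x)}.
  by apply: within_continuousM => //; exact: within_continuous_trig.
rewrite -RintZ; last exact: within_continuous_integrable.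
have chp : {within `[- b, b], continuous (fun x => par c * (h x * trig c k x))}.
  by apply: within_continuousM => //; exact: within_continuous_cst.
rewrite -(Rint_oppr b _ b0 chp).
by apply: eq_Rint => x _; rewrite trig_parity (mulrCA (h _)) (mulrA (par c)) par2 mul1r.
Qed.

(** On a symmetric interval, tested against a function of parity [par c], the reflection is
    multiplication by [par c], so the nonlocal term becomes a scalar factor. *)
Lemma Rint_reflected_trig (b eps : R) (f h : R -> R) c k : 0 <= b ->
  {within `[- b, b], continuous f} -> {within `[- b, b], continuous h} ->
  Rint (- b) b (fun x => (f x + h x - eps * h (- x)) * trig c k x) =
  Rint (- b) b (fun x => f x * trig c k x) +
  (1 - par c * eps) * Rint (- b) b (fun x => h x * trig c k x).
Proof.
move=> b0 cf ch.
have I (g : R -> R) : {within `[- b, b], continuous g} ->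
    mu.-integrable `[- b, b] (EFin \o (fun x => g x * trig c k x)).
  move=> cg; apply/within_continuous_integrable/within_continuousM => //.
  exact: within_continuous_trig.
have chN : {within `[- b, b], continuous (fun x => h (- x))}.
  apply: (within_continuous_comp _ _ h (fun x => - x) ch).
    by move=> x; apply: cvgN.
  by move=> x /=; rewrite !in_itv/= => /andP[h1 h2]; rewrite lerN2 h2 lerNl h1.
have ceN : {within `[- b, b], continuous (fun x => eps * h (- x))}.
  by apply: within_continuousM => //; exact: within_continuous_cst.
have cfh : {within `[- b, b], continuous (fun x => f x + h x)} by exact: within_continuousD.
transitivity (Rint (- b) b (fun x => f x * trig c k x) + Rint (- b) b (fun x => h x * trig c k x)
   - eps * Rint (- b) b (fun x => h (- x) * trig c k x)); last first.
  by rewrite Rint_oppr_trig//; ring.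
rewrite -RintZ; last exact: I.
rewrite -RintD; [|exact: I..]; rewrite -RintB.
- by apply: eq_Rint => x _; ring.
- rewrite (_ : (fun x => _) = (fun x => (f x + h x) * trig c k x)); first exact: I.
  by apply/funext => x; rewrite mulrDl.
- rewrite (_ : (fun x => _) = (fun x => eps * h (- x) * trig c k x)); first exact: I.
  by apply/funext => x; rewrite mulrA.
Qed.

Lemma Rint_exhaustion (a : R) (h : R -> R) : 0 < a -> {within `[- a, a], continuous h} ->
  Rint (- b) b h @[b --> a^'-] --> Rint (- a) a h.
Proof.
move=> a0 ch.
have aa : - a <= a by rewrite (le_trans _ (ltW a0))// oppr_le0 ltW.
have [M M0 hM] := within_continuous_bounded _ _ _ aa ch.
apply/cvgrPdist_le => /= e e0.
near=> b.
have ba : b < a by near: b; exact: nbhs_left_lt.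
have b0 : 0 < b by near: b; exact: nbhs_left_gt.
(* The two end pieces removed have length a - b each. *)
have be : a - b <= e / (M *+ 2).
  rewrite lerBlDr -lerBlDl; apply: ltW; near: b; apply: nbhs_left_gt.
  by rewrite ltrBlDr ltrDl divr_gt0// mulrn_wgt0.
have i c d : - a <= c -> d <= a -> mu.-integrable `[c, d] (EFin \o h).
  move=> ac da; apply: integrableS (within_continuous_integrable _ _ _ ch) => //.
  by apply: subset_itv; rewrite bnd_simp.
have bl : - a <= - b by rewrite lerN2 ltW.
have bb : - b <= b by rewrite (le_trans _ (ltW b0))// oppr_le0 ltW.
rewrite (Rint_split (- a) (- b) a h bl (le_trans bb (ltW ba)) (i _ _ (lexx _) (lexx _))).
rewrite (Rint_split (- b) b a h bb (ltW ba) (i _ _ bl (lexx _))).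
rewrite (_ : _ - _ = Rint (- a) (- b) h + Rint b a h); last by ring.
have h1 : `|Rint (- a) (- b) h| <= M * (- b - - a).
  apply: Rint_norm_le; [exact: bl|exact: i (lexx _) (le_trans bb (ltW ba))|].
  by move=> x /andP[xa xb]; apply: hM; rewrite xa (le_trans xb)// (le_trans bb)// ltW.
have h2 : `|Rint b a h| <= M * (a - b).
  apply: Rint_norm_le; [exact: ltW|exact: i (le_trans bl bb) (lexx _)|].
  by move=> x /andP[xa xb]; apply: hM; rewrite xb (le_trans _ xa)// (le_trans bl).
apply: le_trans (ler_normD _ _) _; apply: le_trans (lerD h1 h2) _.
move: be; rewrite ler_pdivlMr ?mulrn_wgt0// => be.
apply: le_trans be; rewrite mulr2n; lra.
Unshelve. all: end_near. Qed.

End Compactness.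

(** * The ordinary differential equation of a Fourier mode *)

Section Modes.
Context {R : realType}.
Implicit Types (c : bool) (k : nat).

Let cl (T : R) := `[- pi, pi] `*` `[0, T] : set (R * R).

Lemma Omega_clE (T : R) : Omega_cl T = cl T.
Proof.
by apply/seteqP; split => -[x t]; rewrite /Omega_cl /cl /setX /= !in_itv.
Qed.

Variables (T eps : R) (phi psi : R -> R) (u : R -> R -> R) (f : R -> R).
Hypothesis T0 : 0 < T.
Hypothesis reg : regular_solution T eps phi psi u f.
Variables (c : bool) (k : nat).

Let l : R := lam R k.
Let e : R -> R := trig c k.
Let e' (x : R) : R := - par c * l * trig (~~ c) k x.
Let m : R := (1 - par c * eps) * l ^+ 2.

Let uC : {within cl T, continuous (uncurry2 u)}.
Proof. by move: reg => [_ [h _]]; rewrite -Omega_clE. Qed.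

Let in_Omega (b x t : R) : b < pi -> - b <= x <= b -> 0 < t < T -> Omega T (x, t).
Proof.
move=> bpi /andP[bx xb] t0T; split => //=; apply/andP; split; last exact: le_lt_trans bpi.
by apply: lt_le_trans bx; rewrite ltrN2.
Qed.

Let section_continuous (h : R -> R -> R) b t : b < pi -> 0 < t < T ->
  {in Omega T, continuous (uncurry2 h)} -> {within `[- b, b], continuous (fun x => h x t)}.
Proof.
move=> bpi t0T ch; apply: continuous_in_subspaceT => x; rewrite inE/= in_itv/= => xb.
have := ch (x, t); rewrite inE => /(_ (in_Omega _ _ _ bpi xb t0T)) H.
exact: (continuous_comp (@continuous_pairl _ _ t x) H).
Qed.

Lemma solution_section t : 0 <= t <= T -> {within `[- pi, pi], continuous (fun x => u x t)}.
Proof.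
move=> t0T; apply: (within_continuous_comp _ _ (uncurry2 u) (fun x => (x, t)) uC).
  exact: continuous_pairl.
by move=> x /= xpi; split => //=; rewrite in_itv.
Qed.

Let A t := inner (fun x => u x t) e.
Let Ab b t := Rint (- b) b (fun x => u x t * e x).
Let Fb b := Rint (- b) b (fun x => f x * e x).
(* The boundary terms of the integration by parts of dxx u against e on [-b, b]. *)
Let W b t := dx u b t * e b - u b t * e' b - (dx u (- b) t * e (- b) - u (- b) t * e' (- b)).

Let ce : continuous e. Proof. exact: continuous_trig. Qed.
Let ce' : continuous e'.
Proof. by move=> x; apply: cvgM; [exact: cvg_cst|exact: continuous_trig]. Qed.

Let de (x : R) : is_derive x 1 e (e' x). Proof. exact: is_derive_trig. Qed.

Let de' (x : R) : is_derive x 1 e' (- l ^+ 2 * e x).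
Proof.
have h := is_deriveZ (- par c * l) (is_derive_trig (~~ c) k x).
apply: is_derive_eq h _; rewrite /GRing.scale /= negbK parN opprK.
transitivity (- (par c * par c) * l ^+ 2 * e x); first by rewrite /e /l; ring.
by rewrite par2 mulN1r.
Qed.

Let dux x t : Omega T (x, t) -> is_derive x 1 (fun y => u y t) (dx u x t).
Proof.
move=> Oxt; have [[h _] _] := reg; have [d _ _] := h _ _ Oxt.
by apply: DeriveDef; [exact: d|rewrite /dx derive1E].
Qed.

Let duxx x t : Omega T (x, t) -> is_derive x 1 (fun y => dx u y t) (dxx u x t).
Proof.
move=> Oxt; have [[h _] _] := reg; have [_ d _] := h _ _ Oxt.
by apply: DeriveDef; [exact: d|rewrite /dxx derive1E].
Qed.

Let dut x t : Omega T (x, t) -> is_derive t 1 (fun s => u x s) (dt u x t).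
Proof.
move=> Oxt; have [[h _] _] := reg; have [_ _ d] := h _ _ Oxt.
by apply: DeriveDef; [exact: d|rewrite /dt derive1E].
Qed.

Let itvoo (b x : R) : - b < x < b -> - b <= x <= b.
Proof. by move=> /andP[h1 h2]; rewrite !ltW. Qed.

Let intMe (b : R) (h : R -> R) : {within `[- b, b], continuous h} ->
  mu.-integrable `[- b, b] (EFin \o (fun x => h x * e x)).
Proof.
move=> ch; apply/within_continuous_integrable/within_continuousM => //.
exact: within_continuousT.
Qed.

(** Green's formula: two integrations by parts move both derivatives to [e], whose second derivative
    is - l^2 e. *)
Let laplacian_mode b t : 0 < b < pi -> 0 < t < T ->
  Rint (- b) b (fun x => dxx u x t * e x) = W b t - l ^+ 2 * Ab b t.
Proof.
move=> /andP[b0 bpi] t0T; have [[_ [cu [cux [cuxx _]]]] _] := reg.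
have bb : - b < b by rewrite (lt_trans _ b0)// oppr_lt0.
have O x : - b < x < b -> Omega T (x, t) by move=> /itvoo xb; exact: in_Omega xb t0T.
have h0 := section_continuous _ _ _ bpi t0T cu.
have h1 := section_continuous _ _ _ bpi t0T cux.
have h2 := section_continuous _ _ _ bpi t0T cuxx.
have we := within_continuousT `[- b, b] _ ce; have we' := within_continuousT `[- b, b] _ ce'.
have wel : {within `[- b, b], continuous (fun x => - l ^+ 2 * e x)}.
  by apply: within_continuousM => //; exact: within_continuous_cst.
have P1 := Rint_by_parts _ _ _ _ _ _ bb h2 h1 (fun x xb => duxx _ _ (O x xb)) we' we
   (fun x _ => de x).
have P2 := Rint_by_parts _ _ _ _ _ _ bb h1 h0 (fun x xb => dux _ _ (O x xb)) wel we'
   (fun x _ => de' x).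
have P3 : Rint (- b) b (fun x => u x t * (- l ^+ 2 * e x)) = - l ^+ 2 * Ab b t.
  by rewrite /Ab -RintZ; [apply: eq_Rint => x _; ring|exact: intMe].
rewrite P3 in P2.
by rewrite /W; move: P1 P2; rewrite /dx; lra.
Qed.

(** Differentiation under the integral. The constant majorant of u_t comes from a compact rectangle
    inside [Omega], whose time interval from t/2 to (t + T)/2 stays away from 0 and T. *)
Let Ab_derive b t : 0 < b < pi -> 0 < t < T ->
  is_derive t 1 (Ab b) (Rint (- b) b (fun x => dt u x t * e x)).
Proof.
move=> /andP[b0 bpi] t0T; have [[_ [cu [_ [_ cut]]]] _] := reg.
have /andP[tl tr] := t0T.
have bb : - b <= b by rewrite (le_trans _ (ltW b0))// oppr_le0 ltW.
have i1 : 0 < t / 2 by rewrite divr_gt0.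
have i2 : (t + T) / 2 < T by rewrite ltr_pdivrMr// mulr_natr mulr2n ltrD2r.
have i3 : t < (t + T) / 2 by rewrite ltr_pdivlMr// mulr_natr mulr2n ltrD2l.
have i4 : t / 2 < t by rewrite ltr_pdivrMr// mulr_natr mulr2n ltrDl.
have [M M0 HM] : exists2 M : R, 0 < M & forall x s, - b <= x <= b -> t / 2 <= s <= (t + T) / 2 ->
    `|uncurry2 (dt u) (x, s)| <= M.
  apply: rectangle_bounded => -[x s]; rewrite inE/= !in_itv/= => -[xb /andP[sl sr]].
  apply: cut; rewrite inE; apply: (in_Omega b) => //.
  by rewrite (lt_le_trans i1 sl) (le_lt_trans sr i2).
pose F s x := u x s * e x.
have It : `]t / 2, (t + T) / 2[%classic t by rewrite /= in_itv/= i4 i3.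
have inI s : `]t / 2, (t + T) / 2[%classic s -> 0 < s < T.
  by rewrite /= in_itv/= => /andP[h1 h2]; rewrite (lt_trans i1 h1) (lt_trans h2 i2).
have intF s : `]t / 2, (t + T) / 2[%classic s -> mu.-integrable `[- b, b] (EFin \o F s).
  by move=> /inI s0T; apply: intMe; exact: section_continuous bpi s0T cu.
have dF s x : `]t / 2, (t + T) / 2[%classic s -> `[- b, b]%classic x ->
    is_derive s 1 (F ^~ x) (dt u x s * e x).
  move=> /inI s0T; rewrite /= in_itv/= => xb.
  have h := is_deriveZ (e x) (dut x s (in_Omega _ _ _ bpi xb s0T)).
  have -> : F ^~ x = e x \*: (fun s => u x s) by apply/funext => y; rewrite /F mulrC.
  by apply: is_derive_eq h _; rewrite mulrC.
have derF s x : `]t / 2, (t + T) / 2[%classic s -> `[- b, b]%classic x -> derivable (F ^~ x) s 1.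
  by move=> sI xb; exact: (@ex_derive _ _ _ _ _ _ _ (dF s x sI xb)).
have bF s x : `]t / 2, (t + T) / 2[%classic s -> `[- b, b]%classic x ->
    `|partial1of2 F s x| <= M.
  move=> sI xb; rewrite partial1of2E (@derive_val _ _ _ _ _ _ _ (dF s x sI xb)).
  rewrite normrM -[leRHS]mulr1 ler_pM ?trig_le1//.
  move: sI xb; rewrite /= !in_itv/= => /andP[s1 s2] xb; apply: (HM x s xb).
  by rewrite !ltW.
have icst : mu.-integrable `[- b, b] (EFin \o (fun=> M)).
  exact/within_continuous_integrable/within_continuous_cst.
have D1 := (fun mb => derivable_under_integral mb It intF derF (fun=> ltW M0) icst bF) (measurable_itv _).
have D2 := (fun mb => differentiation_under_integral mb It intF derF (fun=> ltW M0) icst bF) (measurable_itv _).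
apply: DeriveDef; first exact: D1.
rewrite -derive1E; transitivity (\int[mu]_(y in `[- b, b]) (partial1of2 F ^~ y) t)%R; first exact: D2.
by apply: eq_Rint => x xb; rewrite partial1of2E (@derive_val _ _ _ _ _ _ _ (dF t x It _))//= in_itv.
Qed.

Let heat_mode b t : 0 < b < pi -> 0 < t < T ->
  Rint (- b) b (fun x => dt u x t * e x) =
  Fb b + (1 - par c * eps) * W b t - m * Ab b t.
Proof.
move=> bpi t0T; have /andP[b0 bpi'] := bpi.
have [[_ [_ [_ [cuxx _]]]] [_ [cf [pde _]]]] := reg.
have L := laplacian_mode b t bpi t0T.
have h2 := section_continuous _ _ _ bpi' t0T cuxx.
have cfb : {within `[- b, b], continuous f}.
  apply: continuous_subspaceW cf; apply: subset_itv; rewrite bnd_simp ?lerN2; exact: ltW.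
rewrite (_ : m * Ab b t = (1 - par c * eps) * (l ^+ 2 * Ab b t)); last by rewrite /m -mulrA.
rewrite -addrA -mulrBr -L -(Rint_reflected_trig b eps f _ c k (ltW b0) cfb h2).
apply: eq_Rint => x xb; congr (_ * _).
have := pde x t (in_Omega _ _ _ bpi' xb t0T).
by move: (dt u x t) (dxx u x t) (dxx u (- x) t) (f x) => a1 a2 a3 a4 <-; ring.
Qed.

Let W_small (eta : R) : 0 < eta ->
  \forall b \near pi^'-, forall t, 0 < t < T -> `|W b t| <= eta.
Proof.
move=> eta0; have [_ [_ [_ [_ [_ [uap [w [cw wE wap]]]]]]]] := reg.
rewrite Omega_clE in cw.
have cswap : continuous (fun p : R * R => (p.2, p.1)).
  by move=> p; apply: (@cvg_pair _ _ _ _ (nbhs p.2) (nbhs p.1)); [exact: cvg_snd|exact: cvg_fst].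
have cswapN : continuous (fun p : R * R => (- p.2, p.1)).
  by move=> p; apply: (@cvg_pair _ _ _ _ (nbhs (- p.2)) (nbhs p.1)); [apply: cvgN; exact: cvg_snd|exact: cvg_fst].
(* [H] is [W] with u_x replaced by its extension [w], hence continuous up to b = pi. The variables
   are swapped because [near_uniform_section] varies the second one and is uniform in the first. *)
pose H (p : R * R) := w p.2 p.1 * e p.2 - u p.2 p.1 * e' p.2 -
   (w (- p.2) p.1 * e (- p.2) - u (- p.2) p.1 * e' (- p.2)).
pose D : set (R * R) := `[0, T] `*` `[- pi, pi].
have cH : {within D, continuous H}.
  have C1 (h : R -> R -> R) : {within cl T, continuous (uncurry2 h)} ->
      {within D, continuous (fun p => h p.2 p.1)}.
    move=> ch; apply: (within_continuous_comp _ _ (uncurry2 h) (fun p : R * R => (p.2, p.1)) ch cswap).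
    by move=> p [].
  have C2 (h : R -> R -> R) : {within cl T, continuous (uncurry2 h)} ->
      {within D, continuous (fun p => h (- p.2) p.1)}.
    move=> ch; apply: (within_continuous_comp _ _ (uncurry2 h) (fun p : R * R => (- p.2, p.1)) ch cswapN).
    move=> p []; rewrite /= !in_itv/= => pT /andP[h1 h2]; split => //=.
    by rewrite in_itv/= lerN2 h2 lerNl h1.
  have E1 (h : R -> R) : continuous h -> {within D, continuous (fun p => h p.2)}.
    by move=> ch; apply: within_continuousT => p; apply: continuous_comp; [exact: cvg_snd|exact: ch].
  have E2 (h : R -> R) : continuous h -> {within D, continuous (fun p => h (- p.2))}.
    by move=> ch; apply: within_continuousT => p; apply: continuous_comp; [apply: cvgN; exact: cvg_snd|exact: ch].
  apply: within_continuousB; apply: within_continuousB; apply: within_continuousM.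
  - exact: C1.
  - exact: E1.
  - exact: C1.
  - exact: E1.
  - exact: C2.
  - exact: E2.
  - exact: C2.
  - exact: E2.
have pp : - pi <= (pi : R) <= pi by rewrite oppr_pi_le lexx.
have := near_uniform_section 0 T (- pi) pi pi H eta cH pp eta0.
rewrite near_withinE => hn.
have hn' : \forall b \near pi^'-, b \in `[- pi, pi] -> forall t, 0 <= t <= T -> `|H (t, pi) - H (t, b)| < eta.
  exact: cvg_at_left_filter hn.
near=> b => t t0T.
have b0 : 0 < b by near: b; apply: nbhs_left_gt; exact: pi_gt0.
have bpi : b < pi by near: b; exact: nbhs_left_lt.
have bI : b \in `[- pi, pi].
  by rewrite in_itv/= (ltW bpi) (le_trans _ (ltW b0))// oppr_le0 ltW// pi_gt0.
have bb : - b <= b by rewrite (le_trans _ (ltW b0))// oppr_le0 ltW.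
have t0T' : 0 <= t <= T by move/andP: t0T => [h1 h2]; rewrite !ltW.
have hb : b \in `[- pi, pi] -> forall t, 0 <= t <= T -> `|H (t, pi) - H (t, b)| < eta by near: b.
have := hb bI t t0T'.
(* Each boundary term is a product of two antiperiodic factors, so its values at pi and - pi
   cancel. *)
have -> : H (t, pi) = 0.
  rewrite /H /= wap// uap// /e /e' !trig_antiperiodic; ring.
have -> : H (t, b) = W b t.
  rewrite /H /W /= !wE//.
    by apply: (in_Omega b) => //; rewrite ?bb ?lexx.
  by apply: (in_Omega b) => //; rewrite ?bb ?lexx.
by rewrite sub0r normrN => /ltW.
Unshelve. all: end_near. Qed.

Hypothesis eps1 : `|eps| < 1.

Let pe_gt0 : 0 < 1 - par c * eps.
Proof.
rewrite subr_gt0; apply: le_lt_trans (ler_norm _) _.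
by rewrite normrM norm_par mul1r.
Qed.

Let m_gt0 : 0 < m.
Proof. by rewrite /m mulr_gt0// exprn_gt0// lam_gt0. Qed.

Let G b t := expR (m * t) * (Ab b t - Fb b / m).
Let Ginf t := expR (m * t) * (A t - inner f e / m).

Let G_derive b t : 0 < b < pi -> 0 < t < T ->
  is_derive t 1 (G b) (expR (m * t) * ((1 - par c * eps) * W b t)).
Proof.
move=> bpi t0T.
have d1 : is_derive t 1 (fun s => m * s) m.
  have h := is_deriveZ m (is_derive_id t (1 : R)).
  by apply: is_derive_eq h _; rewrite /GRing.scale /= mulr1.
have d2 := is_derive1_comp (is_derive_expR (m * t)) d1.
have d3 := is_deriveB (Ab_derive b t bpi t0T) (is_derive_cst (Fb b / m) t (1 : R)).
have d4 := is_deriveM d2 d3.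
apply: is_derive_eq d4 _; rewrite /GRing.scale /= subr0 (heat_mode b t bpi t0T).
have -> : (Ab b - cst (Fb b / m)) t = Ab b t - Fb b / m by [].
have m0 := lt0r_neq0 m_gt0.
by move: (expR (m * t)) (Ab b t) (Fb b) (W b t) => E a b' w'; field.
Qed.

(** By the mean value theorem [G b] varies between s and t by at most a multiple of the supremum of
    |W b|, which tends to 0 as b tends to pi, while [G b] tends to [Ginf] pointwise. *)
Let Ginf_eq s t : 0 < s -> s <= t -> t < T -> Ginf t = Ginf s.
Proof.
move=> s0 st tT; have [_ [_ [cf _]]] := reg.
have t0 : 0 < t := lt_le_trans s0 st.
have lim r : 0 < r < T -> G b r @[b --> pi^'-] --> Ginf r.
  move=> /andP[r0 rT].
  have r0T : 0 <= r <= T by rewrite !ltW.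
  apply: cvgM; first exact: cvg_cst.
  apply: cvgB.
    apply: Rint_exhaustion; first exact: pi_gt0.
    by apply: within_continuousM; [exact: solution_section|exact: within_continuousT].
  apply: cvgM; last exact: cvg_cst.
  apply: Rint_exhaustion; first exact: pi_gt0.
  by apply: within_continuousM; [exact: cf|exact: within_continuousT].
have lt' := lim t; rewrite t0 tT in lt'; have {}lt' := lt' isT.
have ls := lim s; rewrite s0 (le_lt_trans st tT) in ls; have {}ls := ls isT.
have ld : G b t - G b s @[b --> pi^'-] --> Ginf t - Ginf s by exact: cvgB.
apply/eqP; rewrite -subr_eq0 -normr_le0; apply/ler_addgt0Pr => eta eta0; rewrite add0r.
have T0' : T != 0 by rewrite gt_eqF.
(* [K] times a uniform bound of |W b| bounds the variation of [G b]; half of [eta] goes there and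
   half to the passage to the limit. *)
pose K := expR (m * T) * (1 - par c * eps) * T.
have K0 : 0 < K by rewrite !mulr_gt0// expR_gt0.
have eta2 : 0 < eta / 2 by rewrite divr_gt0.
near (pi : R)^'- => b.
have bpi : 0 < b < pi.
  apply/andP; split; first by near: b; apply: nbhs_left_gt; exact: pi_gt0.
  by near: b; exact: nbhs_left_lt.
have Wb : forall t, 0 < t < T -> `|W b t| <= eta / 2 / K.
  by near: b; apply: W_small; rewrite divr_gt0.
have h1 : `|(Ginf t - Ginf s) - (G b t - G b s)| < eta / 2.
  by near: b; exact: (cvgrPdist_lt _ _).1 ld _ eta2.
have in0T x : s <= x <= t -> 0 < x < T.
  by move=> /andP[sx xt]; rewrite (lt_le_trans s0 sx) (le_lt_trans xt tT).
have h2 : `|G b t - G b s| <= expR (m * T) * ((1 - par c * eps) * (eta / 2 / K)) * (t - s).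
  apply: (mean_value_le (G b) (fun x => expR (m * x) * ((1 - par c * eps) * W b x))); first exact: st.
    by move=> x /in0T; exact: G_derive.
  move=> x /in0T x0T; rewrite !normrM (gtr0_norm (expR_gt0 _)) (gtr0_norm pe_gt0).
  apply: ler_pM.
  - exact: expR_ge0.
  - by apply: mulr_ge0; [exact: ltW|exact: normr_ge0].
  - rewrite ler_expR; apply: ler_wpM2l; first exact: ltW.
    by have /andP[_ /ltW] := x0T.
  - by apply: ler_wpM2l; [exact: ltW|exact: Wb].
have h3 : expR (m * T) * ((1 - par c * eps) * (eta / 2 / K)) * (t - s) <= eta / 2.
  apply: (@le_trans _ _ (expR (m * T) * ((1 - par c * eps) * (eta / 2 / K)) * T)).
    apply: ler_wpM2l; last by rewrite lerBlDr; apply: le_trans (ltW tT) _; rewrite lerDl ltW.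
    by rewrite mulr_ge0 ?expR_ge0// mulr_ge0 ?ltW// divr_gt0.
  have E0 := lt0r_neq0 (expR_gt0 (m * T)); have P0 := lt0r_neq0 pe_gt0.
  rewrite /K; move: (expR _) (1 - _) E0 P0 => E P E0 P0.
  by rewrite (_ : _ * T = eta / 2)//; field; rewrite E0 P0 T0'.
rewrite (_ : Ginf t - Ginf s = ((Ginf t - Ginf s) - (G b t - G b s)) + (G b t - G b s)); last by rewrite subrK.
apply: le_trans (ler_normD _ _) _; rewrite (splitr eta).
by apply: lerD; [exact: ltW|exact: le_trans h3].
Unshelve. all: end_near. Qed.

(** Constancy is known in the open time interval only; continuity of [u] on the closed rectangle
    extends it to t = 0 and t = T, where the data are given. *)
Lemma mode_evolution t : 0 <= t <= T ->
  expR (m * t) * (A t - inner f e / m) = A 0 - inner f e / m.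
Proof.
move=> t0T.
have cG : {within `[0, T], continuous Ginf}.
  apply: within_continuousM.
    apply: within_continuousT => s; apply: continuous_comp; last exact: continuous_expR.
    by apply: cvgM; [exact: cvg_cst|exact: cvg_id].
  apply: within_continuousB; last exact: within_continuous_cst.
  exact: (continuous_Rint_section (- pi) pi 0 T (uncurry2 u) e oppr_pi_le uC ce).
have h := within_continuous_interior_eq 0 T Ginf (fun=> Ginf (T / 2)) T0 cG (within_continuous_cst _ _).
have Th : 0 < T / 2 < T by rewrite divr_gt0// ltr_pdivrMr// mulr_natr mulr2n ltrDl.
have hs s : 0 < s < T -> Ginf s = Ginf (T / 2).
  move=> /andP[s0 sT]; have /andP[T2 T2'] := Th.
  have [ss|/ltW ss] := leP s (T / 2); last exact: Ginf_eq.
  by apply/esym; exact: Ginf_eq.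
have {}h := h hs.
have h0 : Ginf 0 = Ginf (T / 2) by apply: h; rewrite lexx ltW.
have := h t t0T; rewrite -h0 /Ginf => ->.
by rewrite mulr0 expR0 mul1r.
Qed.

End Modes.

(** * The solution of the inverse problem *)

Section Coefficients.
Context {R : realType}.
Implicit Types (c : bool) (k : nat).

Lemma C2_continuous (g g1 g2 g3 : R -> R) : C2_with_L2_third g g1 g2 g3 ->
  [/\ {within `[- pi, pi], continuous g}, {within `[- pi, pi], continuous g1} &
      {within `[- pi, pi], continuous g2}].
Proof.
by move=> [d1 d2 c2 _ _]; split => //; apply: has_deriv_on_within_continuous; [exact: d1|exact: d2].
Qed.

Lemma inner_second_deriv (g g1 g2 g3 : R -> R) c k :
  C2_with_L2_third g g1 g2 g3 -> antiperiodic3 g g1 g2 ->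
  inner g2 (trig c k) = - lam R k ^+ 2 * inner g (trig c k).
Proof.
move=> C2 [p0 p1 p2]; have [cg cg1 cg2] := C2_continuous _ _ _ _ C2.
have [d1 d2 _ _ _] := C2.
rewrite (inner_deriv_trig g1 g2 c k cg2 cg1 (fun x => has_deriv_on_is_derive _ _ _ _ _ d2) p1).
rewrite (inner_deriv_trig g g1 (~~ c) k cg1 cg (fun x => has_deriv_on_is_derive _ _ _ _ _ d1) p0).
rewrite negbK parN; transitivity (- (par c * par c) * lam R k ^+ 2 * inner g (trig c k)); first by ring.
by rewrite par2 mulN1r.
Qed.

(** Three shifts of a derivative: two classical ones for g and g1, and one for the primitive g2 of
    g3. Their odd number is why the parity index is negated. *)
Lemma inner_third_deriv (g g1 g2 g3 : R -> R) c k :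
  C2_with_L2_third g g1 g2 g3 -> antiperiodic3 g g1 g2 ->
  inner g (trig c k) = par c * inner g3 (trig (~~ c) k) / lam R k ^+ 3.
Proof.
move=> C2 ap; have [p0 p1 p2] := ap.
have [_ _ _ L2 prim] := C2.
rewrite (inner_primitive_trig g2 g3 (~~ c) k (in_L2_integrable _ L2) prim p2).
rewrite negbK (inner_second_deriv g g1 g2 g3 c k C2 ap) parN.
have l0 := lam_neq0 (R := R) k.
transitivity ((par c * par c) * inner g (trig c k)); first by rewrite par2 mul1r.
by field.
Qed.

(** Given by cases so that it reduces to the factors of the stated series; [rateE] gives the form
    common to both families. *)
Definition rate (eps : R) c : R := if c then 1 - eps else 1 + eps.

Lemma rateE (eps : R) c : rate eps c = 1 - par c * eps.
Proof. by case: c; rewrite /rate /par ?mul1r ?mulN1r ?opprK. Qed.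

Lemma rate_gt0 (eps : R) c : `|eps| < 1 -> 0 < rate eps c.
Proof.
rewrite ltr_norml rateE => /andP[h1 h2].
by case: c; rewrite /par ?mul1r ?mulN1r ?opprK; lra.
Qed.

Definition decay (eps : R) c k (t : R) : R := expR (- rate eps c * lam R k ^+ 2 * t).

Lemma decay_le1 (eps : R) c k (t : R) : `|eps| < 1 -> 0 <= t -> decay eps c k t <= 1.
Proof.
move=> eps1 t0; rewrite -expR0 ler_expR !mulNr oppr_le0 mulr_ge0//.
by apply: mulr_ge0; rewrite ltW// ?rate_gt0// lamX_gt0.
Qed.

Lemma decay_ge0 (eps : R) c k (t : R) : 0 <= decay eps c k t.
Proof. exact: expR_ge0. Qed.

Lemma decay_lt1 (eps : R) c k (t : R) : `|eps| < 1 -> 0 < t -> decay eps c k t < 1.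
Proof.
move=> eps1 t0; rewrite -expR0 ltr_expR !mulNr oppr_lt0 mulr_gt0//.
by rewrite mulr_gt0 ?rate_gt0// lamX_gt0.
Qed.

(** Makes 1 - [decay eps c 0 T] a lower bound of all the denominators. *)
Lemma decay_ge (eps : R) c k (t : R) : `|eps| < 1 -> 0 <= t ->
  decay eps c k t <= decay eps c 0 t.
Proof.
move=> eps1 t0; rewrite ler_expR !mulNr lerN2 ler_wpM2r// ler_wpM2l//.
  by rewrite ltW// rate_gt0.
apply: lerXn2r; rewrite ?nnegrE ?(ltW (lam_gt0 _))//.
by rewrite /lam add0r lerDr.
Qed.

Definition tseries c (al : nat -> R) (x : R) : R := series_sum (fun k => al k * trig c k x).

End Coefficients.

(** * Termwise differentiation and continuity of series *)

Section SeriesCalculus.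
Context {R : realType}.
Implicit Types (c : bool) (k : nat).

(** Summable Lipschitz constants at the point x dominate the difference quotients, and [tannery]
    takes the limit. *)
Lemma is_derive_series_sum (g : nat -> R -> R) (g' M : nat -> R) (x : R) :
  cvgn (series M) -> (forall k, is_derive x 1 (g k) (g' k)) ->
  (\forall y \near x, forall k, `|g k y - g k x| <= M k * `|y - x|) ->
  (\forall y \near x, series_cvg (fun k => g k y)) ->
  is_derive x 1 (fun y => series_sum (fun k => g k y)) (series_sum g').
Proof.
move=> cM dg gM cg.
have cx := nbhs_singleton cg.
have hx : h *: (1 : R) + x @[h --> (0 : R)^'] --> x.
  have h0 : (fun h : R => h *: (1 : R) + x) @ (0 : R) --> (0 : R) *: (1 : R) + x.
    apply: cvgD; last exact: cvg_cst.
    by apply: cvgZr_tmp; exact: cvg_id.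
  by rewrite scale0r add0r in h0; apply: cvg_trans h0; apply: cvg_app; exact: nbhs_dnbhs.
have H : h^-1 *: (series_sum (fun k => g k (h *: (1 : R) + x)) - series_sum (fun k => g k x))
    @[h --> (0 : R)^'] --> series_sum g'.
  have T : series_sum (fun k => h^-1 * (g k (h *: (1 : R) + x) - g k x)) @[h --> (0 : R)^'] --> series_sum g'.
    apply: (tannery _ (fun h k => h^-1 * (g k (h *: (1 : R) + x) - g k x)) g' M cM).
      near=> h => k.
      have h0 : h != 0 by near: h; exact: nbhs_dnbhs_neq.
      have Hk : forall k, `|g k (h *: (1 : R) + x) - g k x| <= M k * `|h *: (1 : R) + x - x|.
        by near: h; exact: hx gM.
      rewrite normrM normfV ler_pdivrMl ?normr_gt0// mulrC.
      by apply: le_trans (Hk k) _; rewrite addrK [_ *: _]mulr1.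
    move=> k; have [d <-] := dg k.
    exact: d.
  apply: cvg_trans T; apply: near_eq_cvg; near=> h.
  have ch : series_cvg (fun k => g k (h *: (1 : R) + x)) by near: h; exact: hx cg.
  rewrite (series_sumZ h^-1 (fun k => g k (h *: (1 : R) + x) - g k x)).
    by rewrite series_sumB.
  exact: is_cvg_seriesB.
apply: DeriveDef; first by apply/cvg_ex; exists (series_sum g').
exact: cvg_lim.
Unshelve. all: end_near. Qed.

Lemma is_derive_tseries c (al : nat -> R) (x : R) :
  cvgn (series (fun k => `|al k|)) -> cvgn (series (fun k => `|al k| * lam R k)) ->
  is_derive x 1 (tseries c al) (tseries (~~ c) (fun k => - par c * lam R k * al k) x).
Proof.
move=> ca cl.
have dg k : is_derive x 1 (fun y => al k * trig c k y) (- par c * lam R k * al k * trig (~~ c) k x).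
  have h := is_deriveZ (al k) (is_derive_trig c k x).
  by apply: is_derive_eq h _; rewrite /GRing.scale /=; ring.
apply: (is_derive_series_sum _ _ _ _ cl dg).
  near=> y => k; rewrite -mulrBr normrM -mulrA ler_wpM2l//; exact: trig_lipschitz.
by near=> y; exact: abs_cvg_trig_series.
Unshelve. all: end_near. Qed.

Lemma is_derive_decay (eps : R) c k (t : R) :
  is_derive t 1 (decay eps c k) (- rate eps c * lam R k ^+ 2 * decay eps c k t).
Proof.
have h := is_deriveZ (- rate eps c * lam R k ^+ 2) (is_derive_id t (1 : R)).
have h2 := is_derive1_comp (is_derive_expR (- rate eps c * lam R k ^+ 2 * t)) h.
by apply: is_derive_eq h2 _; rewrite /GRing.scale /= mulr1 mulrC.
Qed.

Lemma continuous_decay (eps : R) c k : continuous (decay eps c k).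
Proof.
move=> t; apply: differentiable_continuous; apply/derivable1_diffP.
exact: (@ex_derive _ _ _ _ _ _ _ (is_derive_decay eps c k t)).
Qed.

Lemma decay_lipschitz (eps : R) c k (s t : R) : `|eps| < 1 -> 0 <= s -> 0 <= t ->
  `|decay eps c k s - decay eps c k t| <= rate eps c * lam R k ^+ 2 * `|s - t|.
Proof.
move=> eps1; wlog st : s t / s <= t.
  move=> H s0 t0; have [st|/ltW ts] := leP s t; first exact: H.
  by rewrite distrC (distrC s); exact: H.
move=> s0 t0; rewrite distrC (distrC s) (ger0_norm (_ : 0 <= t - s)) ?subr_ge0//.
apply: (mean_value_le _ _ _ _ _ st (fun x _ => is_derive_decay eps c k x)) => x /andP[sx _].
rewrite !mulNr normrN.
have m0 : 0 <= rate eps c * lam R k ^+ 2 by apply: mulr_ge0; rewrite ltW// ?rate_gt0// lamX_gt0.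
rewrite normrM (ger0_norm m0) ger0_norm ?decay_ge0// ler_piMr//.
by apply: decay_le1 => //; exact: le_trans sx.
Qed.

(** The majorant is asked on [A] only: the exponentials are bounded uniformly in k only for t >=
    0. *)
Lemma continuous_tseries_param c (h : nat -> R -> R) (M : nat -> R) (A : set (R * R)) :
  cvgn (series M) -> (forall p k, A p -> `|h k p.2| <= M k) ->
  (forall k, continuous (h k)) ->
  {within A, continuous (fun p => tseries c (fun k => h k p.2) p.1)}.
Proof.
move=> cM hM ch; apply/subspace_continuousP => p Ap.
have FF : ProperFilter (within A (nbhs p)).
  by apply: Build_ProperFilter_ex => P /nbhs_singleton/(_ Ap) Pp; exists p.
apply: (tannery (within A (nbhs p)) _ _ _ cM).
  rewrite near_withinE; near=> q => Aq k.
  by rewrite normrM -[leRHS]mulr1 ler_pM// ?trig_le1//; exact: hM.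
have c2 : q.2 @[q --> within A (nbhs p)] --> p.2.
  by move=> P HP; apply: (cvg_within A); exact: (@cvg_snd _ _ (nbhs p.1) (nbhs p.2)).
have c1 : q.1 @[q --> within A (nbhs p)] --> p.1.
  by move=> P HP; apply: (cvg_within A); exact: (@cvg_fst _ _ (nbhs p.1) (nbhs p.2)).
move=> k; apply: cvgM.
  exact: (cvg_comp _ _ c2 (ch k p.2)).
exact: (cvg_comp _ _ c1 (continuous_trig c k p.1)).
Unshelve. all: end_near. Qed.

Lemma tseries_parity c (al : nat -> R) (x : R) : series_cvg (fun k => al k * trig c k x) ->
  tseries c al (- x) = par c * tseries c al x.
Proof.
move=> ca; rewrite /tseries -series_sumZ//.
by apply: eq_series_sum => k; rewrite trig_parity mulrCA.
Qed.

Lemma tseries_antiperiodic c (al : nat -> R) : cvgn (series (fun k => `|al k|)) ->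
  tseries c al (- pi) = - tseries c al pi.
Proof.
move=> ca; rewrite /tseries -[RHS]mulN1r -series_sumZ; last exact: abs_cvg_trig_series.
by apply: eq_series_sum => k; rewrite trig_antiperiodic mulrN mulN1r.
Qed.

Lemma within_continuous_at {X Y : topologicalType} (A : set X) (f : X -> Y) (x : X) :
  {within A, continuous f} -> (\forall y \near x, A y) -> {for x, continuous f}.
Proof.
move=> /subspace_continuousP cf nA; have Ax := nbhs_singleton nA.
move=> P /(cf x Ax); rewrite /= !nbhs_simpl /within /= => H.
by apply: filterS2 H nA => y h Ay; exact: h.
Qed.

Lemma near_eq_continuous {X Y : topologicalType} (f g : X -> Y) (x : X) :
  (\forall y \near x, f y = g y) -> {for x, continuous g} -> {for x, continuous f}.
Proof.
move=> fg cg; rewrite /prop_for /continuous_at (nbhs_singleton fg).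
apply: cvg_trans cg; apply: near_eq_cvg.
by move: fg; apply: filterS.
Qed.

Lemma near_Omega (T : R) (p : R * R) : Omega T p -> \forall q \near p, Omega T q.
Proof.
case: p => x t [/= /andP[x1 x2] /andP[t1 t2]].
have nx : \forall y \near x, - pi < y < pi.
  have := @near_in_itvoo R (- pi) pi x; rewrite in_itv/= x1 x2 => /(_ isT).
  by apply: filterS => y; rewrite in_itv.
have nt : \forall s \near t, 0 < s < T.
  have := @near_in_itvoo R 0 T t; rewrite in_itv/= t1 t2 => /(_ isT).
  by apply: filterS => y; rewrite in_itv.
exists ([set y | - pi < y < pi], [set s | 0 < s < T]) => //= -[y s] [/= h1 h2].
Qed.

Lemma Omega_sub_cl (T : R) : Omega T `<=` Omega_cl T.
Proof.
by move=> [x t] [/= /andP[x1 x2] /andP[t1 t2]]; split; apply/andP; split; exact: ltW.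
Qed.

End SeriesCalculus.

(** * Explicit solution: necessity of the formulas, then existence *)

Section Solution.
Context {R : realType}.
Implicit Types (c : bool) (k : nat).
Variables (T eps : R) (phi phi1 phi2 phi3 psi psi1 psi2 psi3 : R -> R).
Hypothesis T0 : 0 < T.
Hypothesis eps1 : `|eps| < 1.
Hypothesis phiC : C2_with_L2_third phi phi1 phi2 phi3.
Hypothesis psiC : C2_with_L2_third psi psi1 psi2 psi3.
Hypothesis phiA : antiperiodic3 phi phi1 phi2.
Hypothesis psiA : antiperiodic3 psi psi1 psi2.

Definition jump c k : R := pi^-1 * inner (fun x => psi x - phi x) (trig c k).
(** Chosen so that [amp] (1 - decay t), which vanishes at t = 0, equals [jump] at t = T. *)
Definition amp c k : R := jump c k / (1 - decay eps c k T).

Lemma inner_jump c k : inner (fun x => psi x - phi x) (trig c k) =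
  inner psi (trig c k) - inner phi (trig c k).
Proof.
have [c1 _ _] := C2_continuous _ _ _ _ phiC; have [c2 _ _] := C2_continuous _ _ _ _ psiC.
rewrite /inner -RintB; first by apply: eq_Rint => x _; rewrite mulrBl.
- by apply/within_continuous_integrable/within_continuousM => //; exact: within_continuous_trig.
- by apply/within_continuous_integrable/within_continuousM => //; exact: within_continuous_trig.
Qed.

Lemma jumpE c k : jump c k =
  - par c * (pi^-1 * inner phi3 (trig (~~ c) k) - pi^-1 * inner psi3 (trig (~~ c) k)) / lam R k ^+ 3.
Proof.
rewrite /jump inner_jump (inner_third_deriv _ _ _ _ c k phiC phiA) (inner_third_deriv _ _ _ _ c k psiC psiA).
by move: (lam R k ^+ 3)^-1 => w; ring.
Qed.

Lemma gap_gt0 c k : 0 < 1 - decay eps c k T.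
Proof. by rewrite subr_gt0 decay_lt1. Qed.

(** Of the three powers of [lam] in the denominator of [jumpE], two pay for the weight and one
    remains for [bessel_summable]. *)
Lemma jump_summable c : cvgn (series (fun k => `|jump c k| * lam R k ^+ 2)).
Proof.
have [_ _ _ L1 _] := phiC; have [_ _ _ L2 _] := psiC.
have b1 := bessel_summable _ (~~ c) L1; have b2 := bessel_summable _ (~~ c) L2.
have cM := cvg_series_scale (pi^-1) _ (cvg_series_add _ _ b1 b2).
apply: (dominated_cvg_series _ _ cM) => k.
rewrite ger0_norm; last by rewrite mulr_ge0// exprn_ge0// ltW// lam_gt0.
have p0 : 0 < (pi : R)^-1 by rewrite invr_gt0 pi_gt0.
have l0 := lam_gt0 (R := R) k.
rewrite jumpE !normrM normrN norm_par mul1r normfV (gtr0_norm (exprn_gt0 3 l0)) -mulrBr normrM (gtr0_norm p0).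
rewrite -!mulrA ler_wpM2l ?(ltW p0)// -mulrDl.
rewrite (_ : lam R k ^- 3 * lam R k ^+ 2 = (lam R k)^-1); last by field; rewrite gt_eqF.
by rewrite ler_wpM2r ?ler_normB// invr_ge0 ltW.
Qed.

Lemma amp_summable c : cvgn (series (fun k => `|amp c k| * lam R k ^+ 2)).
Proof.
have cM := cvg_series_scale (1 - decay eps c 0 T)^-1 _ (jump_summable c).
apply: (dominated_cvg_series _ _ cM) => k.
have l2 : 0 <= lam R k ^+ 2 by rewrite exprn_ge0// ltW// lam_gt0.
rewrite ger0_norm; last by rewrite mulr_ge0.
rewrite [X in _ <= X]mulrA; apply: ler_wpM2r => //.
rewrite /amp normrM mulrC; apply: ler_wpM2r => //.
rewrite normfV gtr0_norm ?gap_gt0// lef_pV2 ?posrE ?gap_gt0// lerD2l lerN2.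
by apply: decay_ge => //; exact: ltW.
Qed.

Lemma dominated_tseries (al be : nat -> R) (B : R) :
  cvgn (series (fun k => `|al k| * lam R k ^+ 2)) ->
  (forall k, `|be k| <= B * (`|al k| * lam R k ^+ 2)) ->
  cvgn (series (fun k => `|be k|)).
Proof.
move=> ca H; have cM := cvg_series_scale B _ ca.
by apply: (dominated_cvg_series _ _ cM) => k; rewrite normr_id; exact: H.
Qed.

(** Since [lam] >= 1/2; it lets bounds by |amp| be absorbed in the common majorant |amp| [lam]^2. *)
Lemma lam2_ge k : 1 <= 4 * lam R k ^+ 2.
Proof.
have := lam_ge (R := R) k; have := lam_gt0 (R := R) k => l0 l1.
have : 2^-1 * 2^-1 <= lam R k * lam R k by apply: ler_pM; rewrite ?invr_ge0.
rewrite expr2; lra.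
Qed.

Lemma amp_profile_summable c t : 0 <= t ->
  cvgn (series (fun k => `|amp c k * (1 - decay eps c k t)|)).
Proof.
move=> t0; apply: (dominated_tseries (amp c) _ 4 (amp_summable c)) => k.
have d1 := decay_le1 eps c k t eps1 t0; have d0 := decay_ge0 eps c k t.
rewrite normrM (ger0_norm (_ : 0 <= 1 - _)) ?subr_ge0// mulrCA ler_wpM2l//.
by apply: le_trans (lam2_ge k); lra.
Qed.

Lemma amp_source_summable c :
  cvgn (series (fun k => `|rate eps c * lam R k ^+ 2 * amp c k|)).
Proof.
apply: (dominated_tseries (amp c) _ (rate eps c) (amp_summable c)) => k.
have l2 : 0 <= lam R k ^+ 2 by rewrite exprn_ge0// ltW// lam_gt0.
by rewrite normrM (normrM (rate eps c)) (gtr0_norm (rate_gt0 _ _ eps1)) (ger0_norm l2) -mulrA (mulrC (lam R k ^+ 2)).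
Qed.

Lemma solution_coefficients u f c k t : regular_solution T eps phi psi u f -> 0 <= t <= T ->
  [/\ inner (fun x => u x t) (trig c k) - inner phi (trig c k) =
        pi * (amp c k * (1 - decay eps c k t)) &
      inner f (trig c k) - rate eps c * lam R k ^+ 2 * inner phi (trig c k) =
        pi * (rate eps c * lam R k ^+ 2 * amp c k)].
Proof.
move=> reg t0T.
have ev := mode_evolution T eps phi psi u f T0 reg c k eps1.
have [_ [_ [_ [_ [ic _]]]]] := reg.
have u0 : inner (fun x => u x 0) (trig c k) = inner phi (trig c k).
  by apply: eq_Rint => x xpi; rewrite (ic x xpi).1.
have uT : inner (fun x => u x T) (trig c k) = inner psi (trig c k).
  by apply: eq_Rint => x xpi; rewrite (ic x xpi).2.
rewrite -rateE /= u0 in ev.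
have mE s : 0 <= s <= T -> inner (fun x => u x s) (trig c k) =
    decay eps c k s * (inner phi (trig c k) - inner f (trig c k) / (rate eps c * lam R k ^+ 2))
    + inner f (trig c k) / (rate eps c * lam R k ^+ 2).
  move=> /ev <-; rewrite mulrA /decay -expRD.
  rewrite (_ : - _ * _ * s + _ = 0); last by rewrite !mulNr addNr.
  by rewrite expR0 mul1r subrK.
have TT : 0 <= T <= T by rewrite lexx ltW.
have hT := mE T TT; rewrite uT in hT.
have g0 := lt0r_neq0 (gap_gt0 c k).
have p0 := lt0r_neq0 (pi_gt0 R).
have m0 : rate eps c * lam R k ^+ 2 != 0.
  by rewrite mulf_neq0// ?expf_neq0 ?lam_neq0// gt_eqF// rate_gt0.
(* With D the decay at T, P and Q the modes of phi and psi, and F that of f, evolution up to T reads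
   Q - P = (1 - D) (F/m - P); dividing by 1 - D determines F. *)
have ampE : pi * amp c k = inner f (trig c k) / (rate eps c * lam R k ^+ 2) - inner phi (trig c k).
  rewrite /amp /jump inner_jump hT.
  move: (decay eps c k T) (inner phi _) (inner f _) (rate _ _ * _) pi m0 g0 p0 => D P F m p m0 g0 p0.
  by field; rewrite g0 p0 m0.
split.
  rewrite (mE t t0T) mulrA ampE; ring.
rewrite [RHS]mulrCA ampE.
by move: (rate _ _ * _) m0 => m m0; field.
Qed.

Lemma solution_u_expansion u f x t : regular_solution T eps phi psi u f ->
  - pi <= x <= pi -> 0 <= t <= T ->
  u x t = phi x + (tseries true (fun k => amp true k * (1 - decay eps true k t)) x
                 + tseries false (fun k => amp false k * (1 - decay eps false k t)) x).
Proof.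
move=> reg xpi t0T; have [cphi _ _] := C2_continuous _ _ _ _ phiC.
have cu := solution_section T eps phi psi u f reg t t0T.
apply/eqP; rewrite addrC -subr_eq; apply/eqP.
apply: (fourier_expansion (fun x => u x t - phi x)
   (fun c k => amp c k * (1 - decay eps c k t))) xpi.
- exact: within_continuousB.
- move=> c k; have [<- _] := solution_coefficients u f c k t reg t0T.
  have i (h : R -> R) : {within `[- pi, pi], continuous h} ->
      mu.-integrable `[- pi, pi] (EFin \o (fun x => h x * trig c k x)).
    by move=> ch; apply/within_continuous_integrable/within_continuousM => //; exact: within_continuous_trig.
  rewrite /inner -RintB; [|exact: i cu|exact: i cphi].
  by apply: eq_Rint => y _; rewrite mulrBl.
- by move=> c; apply: amp_profile_summable; case/andP: t0T.
Qed.

(** The expansion is applied to f(x) + phi''(x) - eps phi''(-x), whose coefficients are exactly the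
    second combination in [solution_coefficients], since the modes of phi'' are - [lam]^2 times
    those of phi. *)
Lemma solution_f_expansion u f x : regular_solution T eps phi psi u f ->
  - pi <= x <= pi ->
  f x = - phi2 x + eps * phi2 (- x)
      + (tseries true (fun k => rate eps true * lam R k ^+ 2 * amp true k) x
       + tseries false (fun k => rate eps false * lam R k ^+ 2 * amp false k) x).
Proof.
move=> reg xpi; have [_ _ cphi2] := C2_continuous _ _ _ _ phiC.
have [_ [_ [cf _]]] := reg.
apply/eqP; rewrite addrC -subr_eq opprD opprK addrA; apply/eqP.
have ppi : 0 <= (pi : R) by rewrite ltW// pi_gt0.
apply: (fourier_expansion (fun x => f x + phi2 x - eps * phi2 (- x))
   (fun c k => rate eps c * lam R k ^+ 2 * amp c k)) xpi.
- apply: within_continuousB; first exact: within_continuousD.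
  apply: within_continuousM; first exact: within_continuous_cst.
  apply: (within_continuous_comp _ _ phi2 (fun x => - x) cphi2); first by move=> y; apply: cvgN.
  by move=> y /=; rewrite !in_itv/= => /andP[h1 h2]; rewrite lerN2 h2 lerNl h1.
- move=> c k; have T00 : 0 <= (0 : R) <= T by rewrite lexx ltW.
  have [_ <-] := solution_coefficients u f c k 0 reg T00.
  rewrite /inner (Rint_reflected_trig pi eps f phi2 c k ppi cf cphi2) -rateE.
  have h := inner_second_deriv _ _ _ _ c k phiC phiA; rewrite /inner in h.
  by rewrite h mulNr mulrN mulrA.
- exact: amp_source_summable.
Qed.

(** The factor - 1 accounts for the minus sign before the cosine series in the stated formula; it
    comes from - [par true] in [jumpE]. *)
Lemma u_term1E x t k :
  u_term1 T eps (fsin_coef phi3) (fsin_coef psi3) x t k =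
  - 1 * (amp true k * (1 - decay eps true k t) * trig true k x).
Proof.
rewrite /u_term1 /amp jumpE -[cos (lam R k * x)]/(trig true k x).
have -> : fsin_coef phi3 k = pi^-1 * inner phi3 (trig (~~ true) k) by [].
have -> : fsin_coef psi3 k = pi^-1 * inner psi3 (trig (~~ true) k) by [].
have g0 := lt0r_neq0 (gap_gt0 true k); have l0 := lam_neq0 (R := R) k.
rewrite /decay /rate /par in g0 *.
move: (expR (_ * T)) g0 => E2 g0; move: (expR (_ * t)) => E1.
move: (pi^-1 * _) (pi^-1 * _) (trig _ k x) (lam R k) l0 => p q C l l0.
by field; rewrite l0 g0.
Qed.

Lemma u_term2E x t k :
  u_term2 T eps (fcos_coef phi3) (fcos_coef psi3) x t k =
  amp false k * (1 - decay eps false k t) * trig false k x.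
Proof.
rewrite /u_term2 /amp jumpE -[sin (lam R k * x)]/(trig false k x).
have -> : fcos_coef phi3 k = pi^-1 * inner phi3 (trig (~~ false) k) by [].
have -> : fcos_coef psi3 k = pi^-1 * inner psi3 (trig (~~ false) k) by [].
have g0 := lt0r_neq0 (gap_gt0 false k); have l0 := lam_neq0 (R := R) k.
rewrite /decay /rate /par in g0 *.
move: (expR (_ * T)) g0 => E2 g0; move: (expR (_ * t)) => E1.
move: (pi^-1 * _) (pi^-1 * _) (trig _ k x) (lam R k) l0 => p q C l l0.
by field; rewrite l0 g0.
Qed.

Lemma f_term1E x k :
  f_term1 T eps (fsin_coef phi3) (fsin_coef psi3) x k =
  - 1 * (rate eps true * lam R k ^+ 2 * amp true k * trig true k x).
Proof.
rewrite /f_term1 /amp jumpE -[cos (lam R k * x)]/(trig true k x).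
have -> : fsin_coef phi3 k = pi^-1 * inner phi3 (trig (~~ true) k) by [].
have -> : fsin_coef psi3 k = pi^-1 * inner psi3 (trig (~~ true) k) by [].
have g0 := lt0r_neq0 (gap_gt0 true k); have l0 := lam_neq0 (R := R) k.
rewrite /decay /rate /par in g0 *.
move: (expR (_ * T)) g0 => E2 g0.
move: (pi^-1 * _) (pi^-1 * _) (trig _ k x) (lam R k) l0 => p q C l l0.
by field; rewrite l0 g0.
Qed.

Lemma f_term2E x k :
  f_term2 T eps (fcos_coef phi3) (fcos_coef psi3) x k =
  rate eps false * lam R k ^+ 2 * amp false k * trig false k x.
Proof.
rewrite /f_term2 /amp jumpE -[sin (lam R k * x)]/(trig false k x).
have -> : fcos_coef phi3 k = pi^-1 * inner phi3 (trig (~~ false) k) by [].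
have -> : fcos_coef psi3 k = pi^-1 * inner psi3 (trig (~~ false) k) by [].
have g0 := lt0r_neq0 (gap_gt0 false k); have l0 := lam_neq0 (R := R) k.
rewrite /decay /rate /par in g0 *.
move: (expR (_ * T)) g0 => E2 g0.
move: (pi^-1 * _) (pi^-1 * _) (trig _ k x) (lam R k) l0 => p q C l l0.
by field; rewrite l0 g0.
Qed.

Lemma solution_u_formula u f x t : regular_solution T eps phi psi u f ->
  - pi <= x <= pi -> 0 <= t <= T ->
  [/\ series_cvg (u_term1 T eps (fsin_coef phi3) (fsin_coef psi3) x t),
      series_cvg (u_term2 T eps (fcos_coef phi3) (fcos_coef psi3) x t) &
      u x t = phi x - series_sum (u_term1 T eps (fsin_coef phi3) (fsin_coef psi3) x t)
            + series_sum (u_term2 T eps (fcos_coef phi3) (fcos_coef psi3) x t)].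
Proof.
move=> reg xpi t0T; have /andP[t0 _] := t0T.
have cv c := abs_cvg_trig_series _ c x (amp_profile_summable c t t0).
rewrite (funext (u_term1E x t)) (funext (u_term2E x t)); split.
- exact: (cvg_series_scale (- 1) _ (cv true)).
- exact: cv.
- rewrite (series_sumZ (- 1))//.
  by rewrite mulN1r opprK -addrA; exact: solution_u_expansion reg xpi t0T.
Qed.

Lemma solution_f_formula u f x : regular_solution T eps phi psi u f ->
  - pi <= x <= pi ->
  [/\ series_cvg (f_term1 T eps (fsin_coef phi3) (fsin_coef psi3) x),
      series_cvg (f_term2 T eps (fcos_coef phi3) (fcos_coef psi3) x) &
      f x = - phi2 x + eps * phi2 (- x)
            - series_sum (f_term1 T eps (fsin_coef phi3) (fsin_coef psi3) x)
            + series_sum (f_term2 T eps (fcos_coef phi3) (fcos_coef psi3) x)].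
Proof.
move=> reg xpi.
have cv c := abs_cvg_trig_series _ c x (amp_source_summable c).
rewrite (funext (f_term1E x)) (funext (f_term2E x)); split.
- exact: (cvg_series_scale (- 1) _ (cv true)).
- exact: cv.
- rewrite (series_sumZ (- 1))//.
  by rewrite mulN1r opprK -[RHS]addrA; exact: solution_f_expansion reg xpi.
Qed.

Let prof c k t : R := amp c k * (1 - decay eps c k t).
Let usol x t : R := phi x + (tseries true (fun k => prof true k t) x
                           + tseries false (fun k => prof false k t) x).
(** The termwise derivatives are named separately because [dx] and [dxx] are meaningful only inside
    [Omega], whereas these series live on the closed rectangle; [uxsol] is the extension demanded in
    [regular_solution]. *)
Let uxsol x t : R := phi1 x
  + (tseries false (fun k => - par true * lam R k * prof true k t) x
   + tseries true (fun k => - par false * lam R k * prof false k t) x).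
Let uxxsol x t : R := phi2 x
  + (tseries true (fun k => - lam R k ^+ 2 * prof true k t) x
   + tseries false (fun k => - lam R k ^+ 2 * prof false k t) x).
Let utsol x t : R :=
  tseries true (fun k => rate eps true * lam R k ^+ 2 * amp true k * decay eps true k t) x
  + tseries false (fun k => rate eps false * lam R k ^+ 2 * amp false k * decay eps false k t) x.
Let fsol x : R := - phi2 x + eps * phi2 (- x)
  + (tseries true (fun k => rate eps true * lam R k ^+ 2 * amp true k) x
   + tseries false (fun k => rate eps false * lam R k ^+ 2 * amp false k) x).

(** One summable majorant, up to constant factors, for the coefficients of u, u_x, u_xx, u_t and
    f. *)
Let bound c k : R := `|amp c k| * lam R k ^+ 2.

Let prof_le c k t : 0 <= t -> `|prof c k t| <= `|amp c k|.
Proof.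
move=> t0; have d1 := decay_le1 eps c k t eps1 t0; have d0 := decay_ge0 eps c k t.
rewrite normrM (ger0_norm (_ : 0 <= 1 - _)) ?subr_ge0// ler_piMr//; lra.
Qed.

Let prof_bound0 c k t : 0 <= t -> `|prof c k t| <= 4 * bound c k.
Proof.
move=> /prof_le H; apply: le_trans (H c k) _.
by rewrite /bound mulrCA ler_peMr// lam2_ge.
Qed.

Let prof_bound1 c k t : 0 <= t -> `|- par c * lam R k * prof c k t| <= 2 * bound c k.
Proof.
move=> /prof_le H; have l0 := lam_gt0 (R := R) k; have l1 := lam_ge (R := R) k.
rewrite normrM (normrM (- par c)) normrN norm_par mul1r (gtr0_norm l0) /bound mulrCA mulrC.
apply: ler_pM => //; first exact: ltW.
by rewrite expr2 mulrA ler_peMl//; lra.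
Qed.

Let prof_bound2 c k t : 0 <= t -> `|- lam R k ^+ 2 * prof c k t| <= 1 * bound c k.
Proof.
move=> /prof_le H; rewrite mul1r mulNr normrN normrM (gtr0_norm (lamX_gt0 k 2)) mulrC.
by apply: ler_wpM2r => //; exact/ltW/lamX_gt0.
Qed.

Let bound_cvg B c : cvgn (series (fun k => B * bound c k)).
Proof. exact: cvg_series_scale (amp_summable c). Qed.

Let abs_cvg (be : nat -> R) B c : (forall k, `|be k| <= B * bound c k) ->
  cvgn (series (fun k => `|be k|)).
Proof. exact: dominated_tseries (amp_summable c). Qed.

Let continuous_prof c k : continuous (prof c k).
Proof.
move=> t; apply: cvgM; first exact: cvg_cst.
by apply: cvgB; [exact: cvg_cst|exact: continuous_decay].
Qed.

Let continuous_data (g : R -> R) : {within `[- pi, pi], continuous g} ->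
  {within Omega_cl T, continuous (fun p : R * R => g p.1)}.
Proof.
move=> cg; apply: (within_continuous_comp _ _ g (fun p : R * R => p.1) cg).
  by move=> p; exact: cvg_fst.
by move=> [x t] [/= h _]; rewrite in_itv.
Qed.

(** The family [c] of the functions and the family [d] of the amplitudes are independent, because a
    derivative in x changes the former only. *)
Let series_continuous c d (B : R) (h : nat -> R -> R) :
  (forall k t, 0 <= t -> `|h k t| <= B * bound d k) -> (forall k, continuous (h k)) ->
  {within Omega_cl T, continuous (fun p : R * R => tseries c (fun k => h k p.2) p.1)}.
Proof.
move=> hB ch; apply: (continuous_tseries_param c h _ (Omega_cl T) (bound_cvg B d)) => //.
by move=> [x t] k [_ /andP[t0 _]]; exact: hB.
Qed.

Let usol_continuous : {within Omega_cl T, continuous (uncurry2 usol)}.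
Proof.
have [c0 _ _] := C2_continuous _ _ _ _ phiC.
apply: within_continuousD; first exact: continuous_data.
apply: within_continuousD.
  exact: (series_continuous true true 4 (prof true) (prof_bound0 true) (continuous_prof true)).
exact: (series_continuous false false 4 (prof false) (prof_bound0 false) (continuous_prof false)).
Qed.

Let uxsol_continuous : {within Omega_cl T, continuous (uncurry2 uxsol)}.
Proof.
have [_ c1 _] := C2_continuous _ _ _ _ phiC.
apply: within_continuousD; first exact: continuous_data.
have C c k : continuous (fun t => - par c * lam R k * prof c k t).
  by move=> t; apply: cvgM; [exact: cvg_cst|exact: continuous_prof].
apply: within_continuousD.
  exact: (series_continuous false true 2 (fun k t => - par true * lam R k * prof true k t)
    (prof_bound1 true) (C true)).
exact: (series_continuous true false 2 (fun k t => - par false * lam R k * prof false k t)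
  (prof_bound1 false) (C false)).
Qed.

Let uxxsol_continuous : {within Omega_cl T, continuous (uncurry2 uxxsol)}.
Proof.
have [_ _ c2] := C2_continuous _ _ _ _ phiC.
apply: within_continuousD; first exact: continuous_data.
have C c k : continuous (fun t => - lam R k ^+ 2 * prof c k t).
  by move=> t; apply: cvgM; [exact: cvg_cst|exact: continuous_prof].
apply: within_continuousD.
  exact: (series_continuous true true 1 (fun k t => - lam R k ^+ 2 * prof true k t)
    (prof_bound2 true) (C true)).
exact: (series_continuous false false 1 (fun k t => - lam R k ^+ 2 * prof false k t)
  (prof_bound2 false) (C false)).
Qed.

Let source_bound c k t : 0 <= t ->
  `|rate eps c * lam R k ^+ 2 * amp c k * decay eps c k t| <= rate eps c * bound c k.
Proof.
move=> t0; rewrite normrM (ger0_norm (decay_ge0 _ _ _ _)).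
apply: (@le_trans _ _ (`|rate eps c * lam R k ^+ 2 * amp c k|)).
  by rewrite ler_piMr// decay_le1.
rewrite normrM (normrM (rate eps c)) (gtr0_norm (rate_gt0 _ _ eps1)) (gtr0_norm (lamX_gt0 k 2)).
by rewrite -mulrA (mulrC (lam R k ^+ 2)).
Qed.

Let utsol_continuous : {within Omega_cl T, continuous (uncurry2 utsol)}.
Proof.
have C c k : continuous (fun t => rate eps c * lam R k ^+ 2 * amp c k * decay eps c k t).
  by move=> t; apply: cvgM; [exact: cvg_cst|exact: continuous_decay].
apply: within_continuousD.
  exact: (series_continuous true true (rate eps true)
    (fun k t => rate eps true * lam R k ^+ 2 * amp true k * decay eps true k t)
    (source_bound true) (C true)).
exact: (series_continuous false false (rate eps false)
  (fun k t => rate eps false * lam R k ^+ 2 * amp false k * decay eps false k t)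
  (source_bound false) (C false)).
Qed.

Let usol_dx x t : Omega T (x, t) -> is_derive x 1 (fun y => usol y t) (uxsol x t).
Proof.
move=> [/= xpi /andP[t0 _]]; have [d1 _ _ _ _] := phiC; have t0' := ltW t0.
have D c : is_derive x 1 (tseries c (fun k => prof c k t))
    (tseries (~~ c) (fun k => - par c * lam R k * prof c k t) x).
  apply: is_derive_tseries.
    by apply: (abs_cvg _ 4 c) => k; exact: prof_bound0.
  apply: (dominated_cvg_series _ _ (bound_cvg 2 c)) => k.
  have := prof_bound1 c k t t0'.
  rewrite normrM (normrM (- par c)) normrN norm_par mul1r (gtr0_norm (lam_gt0 k)) mulrC.
  move=> H; rewrite ger0_norm; first exact: H.
  by apply: mulr_ge0 => //; exact: ltW (lam_gt0 k).
have := is_deriveD (has_deriv_on_is_derive _ _ _ _ _ d1 xpi) (is_deriveD (D true) (D false)).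
exact.
Qed.

Let uxsol_dx x t : Omega T (x, t) -> is_derive x 1 (fun y => uxsol y t) (uxxsol x t).
Proof.
move=> [/= xpi /andP[t0 _]]; have [_ d2 _ _ _] := phiC; have t0' := ltW t0.
have D c : is_derive x 1 (tseries (~~ c) (fun k => - par c * lam R k * prof c k t))
    (tseries c (fun k => - lam R k ^+ 2 * prof c k t) x).
  have c1 : cvgn (series (fun k => `|- par c * lam R k * prof c k t|)).
    by apply: (abs_cvg _ 2 c) => k; exact: prof_bound1.
  have c2 : cvgn (series (fun k => `|- par c * lam R k * prof c k t| * lam R k)).
    apply: (dominated_cvg_series _ _ (bound_cvg 1 c)) => k.
    have := prof_bound2 c k t t0'.
    rewrite mulNr normrN normrM (gtr0_norm (lamX_gt0 k 2)) => H.
    rewrite ger0_norm; last by apply: mulr_ge0 => //; exact: ltW (lam_gt0 k).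
    rewrite normrM (normrM (- par c)) normrN norm_par (mul1r `|_|) (gtr0_norm (lam_gt0 k)).
    by rewrite mulrAC -expr2.
  apply: is_derive_eq (is_derive_tseries _ _ x c1 c2) _.
  rewrite negbK; apply: eq_series_sum => k; congr (_ * _).
  rewrite parN; transitivity (- (par c * par c) * lam R k ^+ 2 * prof c k t); first by ring.
  by rewrite par2 mulN1r.
have := is_deriveD (has_deriv_on_is_derive _ _ _ _ _ d2 xpi) (is_deriveD (D true) (D false)).
exact.
Qed.

Let usol_dt x t : Omega T (x, t) -> is_derive t 1 (fun s => usol x s) (utsol x t).
Proof.
move=> [/= _ /andP[t0 _]].
(* The Lipschitz bound for [decay] and the summability of the profiles hold for nonnegative times
   only. *)
have nt : \forall s \near t, 0 <= s.
  have := @near_in_itvoo R 0 (t + 1) t; rewrite in_itv/= t0 ltrDl ltr01 => /(_ isT).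
  by apply: filterS => y; rewrite in_itv/= => /andP[/ltW].
have D c : is_derive t 1 (fun s => tseries c (fun k => prof c k s) x)
    (tseries c (fun k => rate eps c * lam R k ^+ 2 * amp c k * decay eps c k t) x).
  have dg k : is_derive t 1 (fun s => prof c k s * trig c k x)
     (rate eps c * lam R k ^+ 2 * amp c k * decay eps c k t * trig c k x).
    have h := is_deriveZ (- (amp c k * trig c k x)) (is_derive_decay eps c k t).
    have h2 := is_deriveD (is_derive_cst (amp c k * trig c k x) t (1 : R)) h.
    have -> : (fun s => prof c k s * trig c k x) =
        cst (amp c k * trig c k x) + (- (amp c k * trig c k x)) \*: decay eps c k.
      apply/funext => s; rewrite /prof.
      by transitivity (amp c k * trig c k x + - (amp c k * trig c k x) * decay eps c k s); first by ring.
    by apply: is_derive_eq h2 _; rewrite add0r /GRing.scale /=; ring.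
  apply: (is_derive_series_sum (fun k s => prof c k s * trig c k x) _ _ t (amp_source_summable c) dg).
    near=> s => k; have s0 : 0 <= s by near: s.
    rewrite -mulrBl /prof -mulrBr normrM; apply: (@le_trans _ _ (`|amp c k * (1 - decay eps c k s - (1 - decay eps c k t))| * 1)).
      by apply: ler_wpM2l => //; exact: trig_le1.
    rewrite mulr1 normrM (_ : 1 - _ - _ = decay eps c k t - decay eps c k s); last by ring.
    rewrite distrC (normrM _ (amp c k)) (normrM (rate eps c)) (gtr0_norm (rate_gt0 _ _ eps1)) (gtr0_norm (lamX_gt0 k 2)).
    rewrite [leRHS]mulrAC mulrC ler_wpM2r//.
    by apply: decay_lipschitz => //; exact: ltW.
  near=> s; have s0 : 0 <= s by near: s.
  exact: abs_cvg_trig_series (amp_profile_summable c s s0).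
have h := is_deriveD (is_derive_cst (phi x) t (1 : R)) (is_deriveD (D true) (D false)).
have {}h := is_derive_eq h (add0r _).
exact: h.
Unshelve. all: end_near. Qed.

Let near_Omega_x x t : Omega T (x, t) -> \forall y \near x, Omega T (y, t).
Proof. by move=> /near_Omega H; exact: (@continuous_pairl _ _ t x) H. Qed.

Let dx_usol x t : Omega T (x, t) -> dx usol x t = uxsol x t.
Proof. by move=> /usol_dx d; rewrite /dx derive1E; exact: (@derive_val _ _ _ _ _ _ _ d). Qed.

Let dxusol_dx x t : Omega T (x, t) -> is_derive x 1 (fun y => dx usol y t) (uxxsol x t).
Proof.
move=> Oxt; apply: near_eq_is_derive (uxsol_dx _ _ Oxt).
by move: (near_Omega_x _ _ Oxt); apply: filterS => y /dx_usol ->.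
Qed.

Let dxx_usol x t : Omega T (x, t) -> dxx usol x t = uxxsol x t.
Proof. by move=> /dxusol_dx d; rewrite /dxx derive1E; exact: (@derive_val _ _ _ _ _ _ _ d). Qed.

Let dt_usol x t : Omega T (x, t) -> dt usol x t = utsol x t.
Proof. by move=> /usol_dt d; rewrite /dt derive1E; exact: (@derive_val _ _ _ _ _ _ _ d). Qed.

Let interior_continuous (g h : R -> R -> R) : {within Omega_cl T, continuous (uncurry2 h)} ->
  (forall x t, Omega T (x, t) -> g x t = h x t) -> {in Omega T, continuous (uncurry2 g)}.
Proof.
move=> ch gh p /set_mem Op; have nO := near_Omega _ _ Op.
apply: (near_eq_continuous (uncurry2 g) (uncurry2 h)).
  by move: nO; apply: filterS => -[x t]; exact: gh.
apply: within_continuous_at ch _.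
by move: nO; apply: filterS; exact: Omega_sub_cl.
Qed.

Let usol_C21 : C21 T usol.
Proof.
split.
  move=> x t Oxt; split.
  - exact: (@ex_derive _ _ _ _ _ _ _ (usol_dx _ _ Oxt)).
  - exact: (@ex_derive _ _ _ _ _ _ _ (dxusol_dx _ _ Oxt)).
  - exact: (@ex_derive _ _ _ _ _ _ _ (usol_dt _ _ Oxt)).
split; first exact: interior_continuous usol_continuous _.
split; first exact: interior_continuous uxsol_continuous dx_usol.
split; first exact: interior_continuous uxxsol_continuous dxx_usol.
exact: interior_continuous utsol_continuous dt_usol.
Qed.

(** The reflected series is [par c] times the original, so the u_xx terms combine to [rate] [lam]^2
    [amp] (1 - decay), which complements the u_t term [rate] [lam]^2 [amp] decay. *)
Let mode_equation c x t : 0 <= t ->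
  tseries c (fun k => rate eps c * lam R k ^+ 2 * amp c k * decay eps c k t) x
  - tseries c (fun k => - lam R k ^+ 2 * prof c k t) x
  + eps * tseries c (fun k => - lam R k ^+ 2 * prof c k t) (- x) =
  tseries c (fun k => rate eps c * lam R k ^+ 2 * amp c k) x.
Proof.
move=> t0.
have c1 : series_cvg (fun k => - lam R k ^+ 2 * prof c k t * trig c k x).
  by apply/abs_cvg_trig_series/(abs_cvg _ 1 c) => k; exact: prof_bound2.
have c2 : series_cvg (fun k => rate eps c * lam R k ^+ 2 * amp c k * decay eps c k t * trig c k x).
  by apply/abs_cvg_trig_series/(abs_cvg _ (rate eps c) c) => k; exact: source_bound.
rewrite (tseries_parity _ _ _ c1) mulrA (mulrC eps) -addrA -[X in _ + (X + _)]mulN1r -mulrDl addrC.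
rewrite (_ : -1 + par c * eps = - rate eps c); last by rewrite rateE; ring.
rewrite /tseries -series_sumZ// -series_sumD//.
  by apply: eq_series_sum => k; rewrite /prof; ring.
exact: cvg_series_scale.
Qed.

(** At t = T the profiles reduce to the Fourier coefficients of psi - phi, so the final condition is
    an instance of the expansion theorem. *)
Let usol_T x : - pi <= x <= pi -> usol x T = psi x.
Proof.
move=> xpi; have [c1 _ _] := C2_continuous _ _ _ _ phiC; have [c2 _ _] := C2_continuous _ _ _ _ psiC.
have profT c : (fun k => prof c k T) = jump c.
  by apply/funext => k; rewrite /prof /amp divfK// lt0r_neq0// gap_gt0.
have := fourier_expansion (fun x => psi x - phi x) jump (within_continuousB _ _ _ c2 c1) _ _ x xpi.
rewrite /usol !profT => <-; first by rewrite addrC subrK.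
  by move=> c k; rewrite /jump mulrA mulfV ?mul1r// lt0r_neq0// pi_gt0.
by move=> c; rewrite -profT; apply: amp_profile_summable; exact: ltW.
Qed.

Let usol_0 x : usol x 0 = phi x.
Proof.
have z c : tseries c (fun k => prof c k 0) x = 0.
  (* The zero series is written as 0 times a convergent one so that its sum follows by linearity. *)
  rewrite /tseries (eq_series_sum _ (fun k => 0 * 0)).
    rewrite series_sumZ ?mul0r//.
    by apply: (dominated_cvg_series _ _ (bound_cvg 0 c)) => k; rewrite normr0 mul0r.
  by move=> k; rewrite /prof /decay mulr0 expR0 subrr mulr0 !mul0r.
by rewrite /usol !z !addr0.
Qed.

Lemma solution_exists : exists (u : R -> R -> R) (f : R -> R), regular_solution T eps phi psi u f.
Proof.
have [p0 p1 _] := phiA; have [_ _ cphi2] := C2_continuous _ _ _ _ phiC.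
exists usol, fsol; split; first exact: usol_C21.
split; first exact: usol_continuous.
split.
  apply: within_continuousD.
    apply: within_continuousD.
      by move=> z; apply: continuousN; exact: cphi2.
    apply: within_continuousM; first exact: within_continuous_cst.
    apply: (within_continuous_comp _ _ phi2 (fun x => - x) cphi2); first by move=> y; apply: cvgN.
    by move=> y /=; rewrite !in_itv/= => /andP[h1 h2]; rewrite lerN2 h2 lerNl h1.
  apply: within_continuousT => x.
  by apply: cvgD; apply: continuous_trig_series; exact: amp_source_summable.
split.
  move=> x t Oxt; have [/= /andP[xl xr] /andP[t0 tT]] := Oxt.
  have ONx : Omega T (- x, t) by split => /=; rewrite ?t0// ltrN2 xr ltrNl xl.
  rewrite dt_usol// !dxx_usol// /utsol /uxxsol /fsol.
  have m1 := mode_equation true x t (ltW t0); have m2 := mode_equation false x t (ltW t0).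
  rewrite -m1 -m2.
  move: (tseries _ _ _) (tseries _ _ _) (tseries _ _ _) (tseries _ _ _) (tseries _ _ _) (tseries _ _ _) => *; ring.
split.
  by move=> x xpi; split; [exact: usol_0|exact: usol_T].
split.
  move=> t /andP[t0 _]; rewrite /usol p0 !tseries_antiperiodic; try exact: amp_profile_summable.
  by rewrite !opprD.
exists uxsol; split.
- exact: uxsol_continuous.
- by move=> x t /dx_usol ->.
- move=> t /andP[t0 _]; rewrite /uxsol p1 !tseries_antiperiodic.
  + by rewrite !opprD.
  + by apply: (abs_cvg _ 2 false) => k; exact: prof_bound1.
  + by apply: (abs_cvg _ 2 true) => k; exact: prof_bound1.
Qed.

End Solution.

(** Uniqueness is expressed by the formulas: every regular solution takes these values on the closed
    rectangle and interval. The functions are total on R, so agreement can only be claimed there. *)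
Theorem theorem4 (R : realType) (T eps : R)
    (phi phi1 phi2 phi3 psi psi1 psi2 psi3 : R -> R) :
  0 < T -> eps != 0 -> `|eps| < 1 ->
  C2_with_L2_third phi phi1 phi2 phi3 ->
  C2_with_L2_third psi psi1 psi2 psi3 ->
  antiperiodic3 phi phi1 phi2 ->
  antiperiodic3 psi psi1 psi2 ->
  let a1 := fcos_coef phi3 in let a2 := fsin_coef phi3 in
  let b1 := fcos_coef psi3 in let b2 := fsin_coef psi3 in
  (exists (u : R -> R -> R) (f : R -> R), regular_solution T eps phi psi u f) /\
  (forall (u : R -> R -> R) (f : R -> R), regular_solution T eps phi psi u f ->
     (forall x t, - pi <= x <= pi -> 0 <= t <= T ->
        [/\ series_cvg (u_term1 T eps a2 b2 x t),
            series_cvg (u_term2 T eps a1 b1 x t) &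
            u x t = phi x - series_sum (u_term1 T eps a2 b2 x t)
                          + series_sum (u_term2 T eps a1 b1 x t)]) /\
     (forall x, - pi <= x <= pi ->
        [/\ series_cvg (f_term1 T eps a2 b2 x),
            series_cvg (f_term2 T eps a1 b1 x) &
            f x = - phi2 x + eps * phi2 (- x)
                  - series_sum (f_term1 T eps a2 b2 x)
                  + series_sum (f_term2 T eps a1 b1 x)])).
Proof.
move=> T0 _ eps1 phiC psiC phiA psiA a1 a2 b1 b2; split.
  exact: (solution_exists T eps phi phi1 phi2 phi3 psi psi1 psi2 psi3 T0 eps1 phiC psiC phiA psiA).
move=> u f reg; split.
  move=> x t xpi t0T.
  exact: (solution_u_formula T eps phi phi1 phi2 phi3 psi psi1 psi2 psi3 T0 eps1 phiC psiC phiA psiA u f x t reg xpi t0T).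
move=> x xpi.
exact: (solution_f_formula T eps phi phi1 phi2 phi3 psi psi1 psi2 psi3 T0 eps1 phiC psiC phiA psiA u f x reg xpi).
Qed.
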